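(* Let $R$ be a commutative ring with $\frac12\in R$, and let $V\in \mathrm{OUm}_{2n,2m}(R)$ with $m\geq n+2$ and $n\geq 2$. Let $\delta\in \mathrm{SO}_{2n}(R)$ be orthogonal homotopic to the identity, and let $\delta(T)\in\mathrm{SO}_{2n}(R[T])$ be a homotopy of $\delta$. Then there exists $\sigma(T)\in \mathrm{SO}_{2m}(R[T],(T))$ such that $$\delta(T)V=V\sigma(T)\quad\text{and}\quad \sigma(T)^{-1}(\delta(T)\perp I_{2m-2n})\in \mathrm{EO}_{2m}(R[T],(T)).$$ Moreover, if $\sigma:=\sigma(1)$, then $\delta V=V\sigma$ and $\sigma^{-1}(\delta\perp I_{2m-2n})\in \mathrm{EO}_{2m}(R)$.
   Context: All rings are commutative with $1\neq 0$. Let $\phi_1=\begin{bmatrix}0&1\\1&0\end{bmatrix}$ and $\phi_n=\phi_{n-1}\perp\phi_1$ for $n>1$, where $\alpha\perp\beta$ denotes the block diagonal matrix with blocks $\alpha,\beta$. $\mathrm{O}_{2m}(R)=\{\alpha\in \mathrm{GL}_{2m}(R)\mid \alpha^t\phi_m\alpha=\phi_m\}$ and $\mathrm{SO}_{2m}(R)$ is its subgroup of matrices of determinant $1$. Let $\sigma_0$ be the permutation of the natural numbers with $\sigma_0(2i)=2i-1$, $\sigma_0(2i-1)=2i$. For $1\leq i\neq j\leq 2m$ with $i\neq\sigma_0(j)$ and $z\in R$, put $oe_{ij}(z)=I_{2m}+zE_{ij}-zE_{\sigma_0(j)\sigma_0(i)}$, where $E_{ij}$ is the matrix unit. $\mathrm{EO}_{2m}(R)$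 is the subgroup of $\mathrm{O}_{2m}(R)$ generated by all the $oe_{ij}(z)$. $\mathrm{Um}_{2n,2m}(R)$ is the set of $2n\times 2m$ matrices over $R$ having a right inverse, and $\mathrm{OUm}_{2n,2m}(R)=\{V\in \mathrm{Um}_{2n,2m}(R)\mid V\phi_mV^t=\phi_n\}$. A matrix $\delta\in \mathrm{SO}_{2n}(R)$ is orthogonal homotopic to the identity if there is $\delta(T)\in \mathrm{SO}_{2n}(R[T])$ with $\delta(0)=I_{2n}$ and $\delta(1)=\delta$; such a $\delta(T)$ is called a homotopy of $\delta$. $\mathrm{SO}_{2m}(R[T],(T))$ is the group of $\sigma(T)\in \mathrm{SO}_{2m}(R[T])$ with $\sigma(0)=I_{2m}$. $\mathrm{EO}_{2m}(R[T],(T))$ is the relative elementary orthogonal group, i.e. the normal closure in $\mathrm{EO}_{2m}(R[T])$ of the $oe_{ij}(f)$ with $f\in(T)$; equivalently the group of elements of $\mathrm{EO}_{2m}(R[T])$ that become $I_{2m}$ at $T=0$. *)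

(* Defs.v *)
From HB Require Import structures.
From mathcomp Require Import all_boot all_order all_algebra.

Set Implicit Arguments.
Unset Strict Implicit.
Unset Printing Implicit Defensive.

Import GRing.Theory.
Local Open Scope ring_scope.

(* R is only a comNzRingType, so neither 'M[R]_n nor 'M[{poly R}]_n carries a
   canonical inverse: inverses are given relationally. *)
Definition is_inverse (R : comNzRingType) (k : nat) (A B : 'M[R]_k) : Prop :=
  A *m B = 1%:M /\ B *m A = 1%:M.

Definition GL (R : comNzRingType) (k : nat) (A : 'M[R]_k) : Prop :=
  exists B, is_inverse A B.

Definition perp (R : comNzRingType) (p q : nat) (A : 'M[R]_p) (B : 'M[R]_q) :
  'M[R]_(p + q) := block_mx A 0 0 B.

Definition phi1 (R : comNzRingType) : 'M[R]_2 := \matrix_(i, j) (i != j)%:R.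

Lemma double_addn2 (n : nat) : (n.*2 + 2 = n.+1.*2)%N.
Proof. by rewrite addn2 doubleS. Qed.

Fixpoint phi (R : comNzRingType) (n : nat) : 'M[R]_(n.*2) :=
  if n is n'.+1 then
    castmx (double_addn2 n', double_addn2 n') (perp (phi R n') (phi1 R))
  else 0.

Definition O (R : comNzRingType) (m : nat) (A : 'M[R]_(m.*2)) : Prop :=
  GL A /\ A^T *m phi R m *m A = phi R m.

Definition SO (R : comNzRingType) (m : nat) (A : 'M[R]_(m.*2)) : Prop :=
  O A /\ \det A = 1.

(* Indices start at 0: the pairs {2i-1, 2i} become {2i, 2i+1}. *)
Definition sigma0_nat (k : nat) : nat := if odd k then k.-1 else k.+1.

Lemma sigma0_subproof (m : nat) (i : 'I_(m.*2)) : (sigma0_nat i < m.*2)%N.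
Proof.
rewrite /sigma0_nat; case: ifPn => oi; first exact: leq_ltn_trans (leq_pred _) _.
rewrite ltn_neqAle ltn_ord andbT; apply: contra oi => /eqP e.
by rewrite -[odd i]negbK -oddS e odd_double.
Qed.

Definition sigma0 (m : nat) (i : 'I_(m.*2)) : 'I_(m.*2) :=
  Ordinal (sigma0_subproof i).

Definition oe (R : comNzRingType) (m : nat) (i j : 'I_(m.*2)) (z : R) :
  'M[R]_(m.*2) :=
  1%:M + z *: delta_mx i j - z *: delta_mx (sigma0 j) (sigma0 i).

(* The subgroup generated by a set S of invertible matrices. *)
Inductive generated (R : comNzRingType) (k : nat) (S : 'M[R]_k -> Prop) :
    'M[R]_k -> Prop :=
| generated_mem A : S A -> generated S A
| generated_one : generated S 1%:M
| generated_mul A B : generated S A -> generated S B -> generated S (A *m B)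
| generated_inv A B : generated S A -> is_inverse A B -> generated S B.

Definition EO (R : comNzRingType) (m : nat) : 'M[R]_(m.*2) -> Prop :=
  generated (fun A => exists (i j : 'I_(m.*2)) (z : R),
    [/\ i != j, i != sigma0 j & A = oe i j z]).

(* EO_{2m}(R[T], (T)): the normal closure is the subgroup generated by all the
   EO_{2m}(R[T])-conjugates of the oe_ij(f) with f in (T). *)
Definition EO_rel (R : comNzRingType) (m : nat) :
    'M[{poly R}]_(m.*2) -> Prop :=
  generated (fun A => exists (G H : 'M[{poly R}]_(m.*2)) (i j : 'I_(m.*2))
      (f : {poly R}),
    [/\ EO G, is_inverse G H, i != j /\ i != sigma0 j,
        (exists g : {poly R}, f = g * 'X) & A = G *m oe i j f *m H]).

Definition Um (R : comNzRingType) (p q : nat) (V : 'M[R]_(p, q)) : Prop :=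
  exists W : 'M[R]_(q, p), V *m W = 1%:M.

Definition OUm (R : comNzRingType) (n m : nat) (V : 'M[R]_(n.*2, m.*2)) :
    Prop :=
  Um V /\ V *m phi R m *m V^T = phi R n.

Definition eval_mx (R : comNzRingType) (p q : nat) (a : R)
    (A : 'M[{poly R}]_(p, q)) : 'M[R]_(p, q) :=
  map_mx (horner_eval a) A.

Definition const_polymx (R : comNzRingType) (p q : nat) (A : 'M[R]_(p, q)) :
    'M[{poly R}]_(p, q) :=
  map_mx polyC A.

Definition SO_rel (R : comNzRingType) (m : nat) (A : 'M[{poly R}]_(m.*2)) :
    Prop :=
  SO A /\ eval_mx 0 A = 1%:M.

Definition homotopy_of (R : comNzRingType) (n : nat) (d : 'M[R]_(n.*2))
    (D : 'M[{poly R}]_(n.*2)) : Prop :=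
  [/\ SO D, eval_mx 0 D = 1%:M & eval_mx 1 D = d].

Definition homotopic_to_id (R : comNzRingType) (n : nat) (d : 'M[R]_(n.*2)) :
    Prop :=
  SO d /\ exists D : 'M[{poly R}]_(n.*2), homotopy_of d D.

Lemma double_subnKC (n m : nat) :
  (n + 2 <= m)%N -> (n.*2 + (m.*2 - n.*2) = m.*2)%N.
Proof.
by move=> h; rewrite subnKC // leq_double (leq_trans _ h) // leq_addr.
Qed.

(* A ⊥ I_{2m-2n} as a matrix of size 2m. *)
Definition perp_id (R : comNzRingType) (n m : nat) (hmn : (n + 2 <= m)%N)
    (A : 'M[R]_(n.*2)) : 'M[R]_(m.*2) :=
  castmx (double_subnKC hmn, double_subnKC hmn)
    (perp A (1%:M : 'M[R]_(m.*2 - n.*2))).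

(* Main.v *)
(** Let V* = phi V^t phi, so that V V* = 1. The matrix sigma = 1 + V* (delta - 1) V
is orthogonal, extends the action of delta from the hyperbolic summand spanned by
the rows of V, and satisfies delta V = V sigma; for V1 = (I | 0) it is
delta _|_ I. It remains to compare the two homomorphisms delta |-> sigma_V(delta)
and sigma_V1 modulo EO on homotopies g(Y), g(0) = 1 (here over R[T], with
g(Y) = delta(TY)). Call s good if sigma_V(g(s^N)) lies in sigma_V1(g(s^N)) EO for
some N and all g. Since EO is normalized by the image of sigma_V1 (this uses the
free room m > n), Quillen's argument shows that the good s form a radical ideal.
Over R[1/s], clearing one pair of rows of V at a time with a unit entry as pivot
carries V to V1 by elementary transformations, and conjugation by an elementary
transformation with denominator s^k preserves integrality of elements that are
sufficiently divisible by s. As each row of V is unimodular, 1 is good.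

No localization is formed: a matrix over R[1/s] is replaced by a multiple over R,
and 1 + c x is represented by x. *)
Require Import Defs.
From HB Require Import structures.
From mathcomp Require Import all_boot all_order all_algebra.
From mathcomp Require Import zify ring.

Set Implicit Arguments.
Unset Strict Implicit.
Unset Printing Implicit Defensive.

Import GRing.Theory.
Local Open Scope ring_scope.

(** * The hyperbolic form and Siegel transformations *)

Section Indices.
Variable m : nat.
Implicit Types i j : 'I_(m.*2).

Lemma sigma0K : involutive (@sigma0 m).
Proof.
move=> i; apply: val_inj; rewrite /= /sigma0_nat.
by case: (boolP (odd i)) => oi; case: ifP => o; lia.
Qed.

Lemma sigma0_neq i : sigma0 i != i.
Proof. by rewrite -val_eqE /= /sigma0_nat; case: ifPn; lia. Qed.

Lemma sigma0_eq i j : (sigma0 i == sigma0 j) = (i == j).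
Proof. exact: (inj_eq (inv_inj sigma0K)). Qed.

Lemma sigma0_eqC i j : (sigma0 i == j) = (i == sigma0 j).
Proof. by rewrite -sigma0_eq sigma0K. Qed.

Lemma sigma0_lt i k : (sigma0 i < k.*2)%N = (i < k.*2)%N.
Proof. by rewrite /= /sigma0_nat; case: ifPn; lia. Qed.

End Indices.

(* Locked, so that rewriting with [mulmxA] does not look inside. *)
HB.lock Definition star (R : comNzRingType) (p q : nat)
    (A : 'M[R]_(p.*2, q.*2)) : 'M[R]_(q.*2, p.*2) :=
  phi R q *m A^T *m phi R p.

HB.lock Definition dual (R : comNzRingType) (m : nat) (u : 'cV[R]_(m.*2)) :
    'rV[R]_(m.*2) :=
  u^T *m phi R m.

Section Form.
Variable R : comNzRingType.

Lemma phiE m i j : phi R m i j = (i == sigma0 j)%:R.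
Proof.
elim: m i j => [[]//|m IH] i j /=; rewrite castmxE.
rewrite -[cast_ord _ i]splitK -[cast_ord _ j]splitK.
case: splitP => i' ei; case: splitP => j' ej /=; rewrite /perp.
- rewrite block_mxEul IH; congr (_%:R); congr (nat_of_bool _).
  rewrite -!val_eqE /=; move: ei ej => /= -> ->.
  by [].
- rewrite block_mxEur mxE; move: ei ej => /= ei ej.
  rewrite -val_eqE /= ei ej /sigma0_nat.
  have := ltn_ord i'; case: ifPn; case: eqP => //; lia.
- rewrite block_mxEdl mxE; move: ei ej => /= ei ej.
  rewrite -val_eqE /= ei ej /sigma0_nat.
  have := ltn_ord j'; case: ifPn; case: eqP => //; lia.
- rewrite block_mxEdr mxE; move: ei ej => /= ei ej.
  rewrite -!val_eqE /= ei ej /sigma0_nat; congr (_%:R); congr (nat_of_bool _).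
  by case: i' {ei} => [[|[|i']] //= _]; case: j' {ej} => [[|[|j']] //= _];
  case: ifP; lia.
Qed.

Lemma phi_tr m : (phi R m)^T = phi R m.
Proof. by apply/matrixP=> i j; rewrite mxE !phiE -sigma0_eqC eq_sym. Qed.

Lemma phi_mul m p (A : 'M[R]_(m.*2, p)) i j : (phi R m *m A) i j = A (sigma0 i) j.
Proof.
rewrite mxE (bigD1 (sigma0 i)) //= phiE sigma0K eqxx mul1r big1 ?addr0 // => k ne.
by rewrite phiE -sigma0_eqC eq_sym (negbTE ne) mul0r.
Qed.

Lemma mul_phi m p (A : 'M[R]_(p, m.*2)) i j : (A *m phi R m) i j = A i (sigma0 j).
Proof.
rewrite mxE (bigD1 (sigma0 j)) //= phiE eqxx mulr1 big1 ?addr0 // => k ne.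
by rewrite phiE (negbTE ne) mulr0.
Qed.

Lemma phiK m : phi R m *m phi R m = 1%:M.
Proof.
by apply/matrixP=> i j; rewrite phi_mul phiE mxE sigma0_eq.
Qed.


Lemma starE p q (A : 'M[R]_(p.*2, q.*2)) i j :
  star A i j = A (sigma0 j) (sigma0 i).
Proof. by rewrite ?star.unlock ?dual.unlock mul_phi phi_mul mxE. Qed.

Lemma starK p q (A : 'M[R]_(p.*2, q.*2)) : star (star A) = A.
Proof. by apply/matrixP=> i j; rewrite !starE !sigma0K. Qed.

Lemma starM p q r (A : 'M[R]_(p.*2, q.*2)) (B : 'M[R]_(q.*2, r.*2)) :
  star (A *m B) = star B *m star A.
Proof.
by rewrite ?star.unlock ?dual.unlock trmx_mul !mulmxA -[_ *m phi R q *m phi R q]mulmxA phiK mulmx1.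
Qed.

Lemma starD p q (A B : 'M[R]_(p.*2, q.*2)) : star (A + B) = star A + star B.
Proof. by apply/matrixP=> i j; rewrite [RHS]mxE !starE ?mxE. Qed.

Lemma starN p q (A : 'M[R]_(p.*2, q.*2)) : star (- A) = - star A.
Proof. by apply/matrixP=> i j; rewrite [RHS]mxE !starE ?mxE. Qed.

Lemma starZ p q a (A : 'M[R]_(p.*2, q.*2)) : star (a *: A) = a *: star A.
Proof. by apply/matrixP=> i j; rewrite [RHS]mxE !starE ?mxE. Qed.

Lemma star1 p : star (1%:M : 'M[R]_(p.*2)) = 1%:M.
Proof. by apply/matrixP=> i j; rewrite starE ![_%:M _ _]mxE sigma0_eq eq_sym. Qed.

Variable m : nat.
Implicit Types (i j k l : 'I_(m.*2)) (u v w : 'cV[R]_(m.*2)).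

Definition bf u v : R := (dual u *m v) 0 0.
(** The standard skew-adjoint map of a pair. For orthogonal isotropic [u], [v] it squares to zero,
    and [1 + z wedge u v] is then orthogonal. *)
Definition wedge u v : 'M[R]_(m.*2) := u *m dual v - v *m dual u.
Definition ev i : 'cV[R]_(m.*2) := delta_mx i 0.

Lemma dualE u j : dual u 0 j = u (sigma0 j) 0.
Proof. by rewrite ?star.unlock ?dual.unlock mul_phi mxE. Qed.

Lemma dual_mul u v : dual u *m v = (bf u v)%:M.
Proof. by apply/matrixP=> i j; rewrite !ord1 [RHS]mxE mulr1n. Qed.

Lemma bfE u v : bf u v = \sum_i u (sigma0 i) 0 * v i 0.
Proof. by rewrite /bf mxE; apply: eq_bigr => i _; rewrite dualE. Qed.

Lemma bfC u v : bf u v = bf v u.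
Proof.
rewrite !bfE (reindex_inj (inv_inj (@sigma0K m))); apply: eq_bigr => i _ /=.
by rewrite sigma0K mulrC.
Qed.

Lemma bfDl u v w : bf (u + v) w = bf u w + bf v w.
Proof. by rewrite !bfE -big_split; apply: eq_bigr => i _; rewrite mxE mulrDl. Qed.
Lemma bfZl a u w : bf (a *: u) w = a * bf u w.
Proof. by rewrite !bfE mulr_sumr; apply: eq_bigr => i _; rewrite mxE mulrA. Qed.
Lemma bfDr u v w : bf w (u + v) = bf w u + bf w v.
Proof. by rewrite bfC bfDl !(bfC w). Qed.
Lemma bfZr a u w : bf w (a *: u) = a * bf w u.
Proof. by rewrite bfC bfZl (bfC w). Qed.
Lemma bf_evl i v : bf (ev i) v = v (sigma0 i) 0.
Proof.
rewrite bfE (bigD1 (sigma0 i)) //= sigma0K mxE !eqxx mul1r big1 ?addr0 // => k ne.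
by rewrite mxE sigma0_eqC (negbTE ne) mul0r.
Qed.
Lemma bf_evr i v : bf v (ev i) = v (sigma0 i) 0.
Proof. by rewrite bfC bf_evl. Qed.
Lemma evE i j : ev i j 0 = (j == i)%:R.
Proof. by rewrite mxE eqxx andbT. Qed.
Lemma bf_ev i j : bf (ev i) (ev j) = (sigma0 i == j)%:R.
Proof. by rewrite bf_evl evE. Qed.

Lemma dualD u v : dual (u + v) = dual u + dual v.
Proof. by rewrite ?star.unlock ?dual.unlock linearD mulmxDl. Qed.
Lemma dualZ a u : dual (a *: u) = a *: dual u.
Proof. by rewrite ?star.unlock ?dual.unlock linearZ -scalemxAl. Qed.
Lemma dualMl (A : 'M[R]_(m.*2)) u : dual (star A *m u) = dual u *m A.
Proof. by rewrite ?star.unlock ?dual.unlock !trmx_mul trmxK phi_tr -!mulmxA phiK mulmx1. Qed.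
Lemma bfMl (A : 'M[R]_(m.*2)) u v : bf (star A *m u) v = bf u (A *m v).
Proof. by rewrite /bf dualMl mulmxA. Qed.

Lemma wedge_conj (A : 'M[R]_(m.*2)) u v :
  star A *m wedge u v *m A = wedge (star A *m u) (star A *m v).
Proof. by rewrite /wedge !dualMl mulmxBr mulmxBl !mulmxA. Qed.

Lemma star_outer u v : star (u *m dual v) = v *m dual u.
Proof. by rewrite ?star.unlock ?dual.unlock !trmx_mul trmxK phi_tr !mulmxA phiK mul1mx. Qed.

Lemma star_wedge u v : star (wedge u v) = - wedge u v.
Proof. by rewrite /wedge starD starN !star_outer opprB. Qed.

Lemma wedgeC u v : wedge u v = - wedge v u.
Proof. by rewrite /wedge opprB. Qed.

Lemma wedgeZl a u v : wedge (a *: u) v = a *: wedge u v.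
Proof. by rewrite /wedge dualZ -scalemxAl -scalemxAr scalerBr. Qed.
Lemma wedgeZr a u v : wedge u (a *: v) = a *: wedge u v.
Proof. by rewrite wedgeC wedgeZl -scalerN -wedgeC. Qed.

Lemma outer_mul u v w (x : 'cV[R]_(m.*2)) :
  (u *m dual v) *m (w *m dual x) = bf v w *: (u *m dual x).
Proof.
by rewrite mulmxA -(mulmxA u) dual_mul mul_mx_scalar -scalemxAl.
Qed.

(** In this basis-free form, conjugation by an orthogonal matrix just moves the two vectors. The
    index [j] is flipped because [dual (ev R (sigma0 j))] is the row reading coordinate [j]. *)
Lemma oe_wedge i j (z : R) : oe i j z = 1%:M + z *: wedge (ev i) (ev (sigma0 j)).
Proof.
rewrite /oe /wedge scalerBr addrA; congr (_ + _ *: _ - _ *: _);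
  apply/matrixP=> k l; rewrite !mxE big_ord1 dualE !mxE !eqxx !andbT -natrM mulnb //.
  by rewrite sigma0_eq.
by rewrite sigma0_eqC.
Qed.

End Form.

Section Entries.
Variables (R : comNzRingType) (p q : nat).
Implicit Types A B : 'M[R]_(p, q).
Lemma addmxE A B i j : (A + B) i j = A i j + B i j. Proof. by rewrite mxE. Qed.
Lemma oppmxE A i j : (- A) i j = - A i j. Proof. by rewrite mxE. Qed.
Lemma scalemxE a A i j : (a *: A) i j = a * A i j. Proof. by rewrite mxE. Qed.
Lemma mx0E i j : (0 : 'M[R]_(p, q)) i j = 0. Proof. by rewrite mxE. Qed.
End Entries.

(* Matrices do not commute, so [ring] is applied to the entries of an expanded
   identity, each matrix monomial being an atom. *)
Ltac mx_expand :=
  rewrite ?(mulmxDl, mulmxDr, mulmxN, mulNmx, mulmx1, mul1mx, mulmx0, mul0mx,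
    scalerDr, scalerN, scaler0, =^~ scalemxAl, =^~ scalemxAr, scalerA, mulmxA).
Ltac mx_entries :=
  let i := fresh in let j := fresh in
  apply/matrixP=> i j; rewrite ?(addmxE, oppmxE, scalemxE, mx0E).

(** * Congruence elements, their group law and commutators *)

Section Quasi.
Variables (R : comNzRingType) (m : nat).
Implicit Types (c y : R) (x : 'M[R]_(m.*2)) (u v w : 'cV[R]_(m.*2)).

(* The group law on x transported from 1 + c x. *)
Definition qop c x x' : 'M[R]_(m.*2) := x + x' + c *: (x *m x').

(* The elements [1 + c x] with [x] tracked form the subgroup generated by the
   [oe_ij(c y f)]. Keeping [x] instead of [c x] replaces a division by [c],
   which may be a zero divisor. *)
Inductive tracked c y : 'M[R]_(m.*2) -> Prop :=
| tracked_zero : tracked c y 0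
| tracked_op x x' : tracked c y x -> tracked c y x' -> tracked c y (qop c x x')
| tracked_gen (k l : 'I_(m.*2)) (f : R) : k != l -> k != sigma0 l ->
    tracked c y ((y * f) *: wedge (ev R k) (ev R l)).

Lemma qopA c x1 x2 x3 : qop c x1 (qop c x2 x3) = qop c (qop c x1 x2) x3.
Proof. by rewrite /qop; mx_expand; mx_entries; ring. Qed.

Lemma qop0 c x : qop c x 0 = x.
Proof. by rewrite /qop mulmx0 scaler0 !addr0. Qed.

Lemma qopE c x x' : 1%:M + c *: qop c x x' = (1%:M + c *: x) *m (1%:M + c *: x').
Proof. by rewrite /qop; mx_expand; mx_entries; ring. Qed.

Lemma tracked_weaken c y t x : tracked c (y * t) x -> tracked c y x.
Proof.
elim=> [|x1 x2 _ Q1 _ Q2|k l f kl skl]; first exact: tracked_zero.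
  exact: tracked_op.
by rewrite -mulrA; apply: tracked_gen.
Qed.

Lemma tracked_EO y x : tracked 1 y x -> EO (1%:M + x).
Proof.
elim=> [|x1 x2 _ E1 _ E2|k l f kl skl]; first by rewrite addr0; apply: generated_one.
  by have:= qopE 1 x1 x2; rewrite !scale1r => ->; apply: generated_mul.
apply: generated_mem; exists k, (sigma0 l), (y * f).
by rewrite oe_wedge sigma0K.
Qed.

(** The inner product [A *m star A] contributes the factor [d], so conjugation without denominators
    carries the group law of modulus [c * d] to that of modulus [c]. *)
Lemma qop_star c d x x' (A : 'M[R]_(m.*2)) : A *m star A = d%:M ->
  star A *m qop (c * d) x x' *m A = qop c (star A *m x *m A) (star A *m x' *m A).
Proof.
move=> AA; rewrite /qop; mx_expand.
rewrite -(mulmxA _ A (star A)) AA mul_mx_scalar; mx_expand.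
by congr (_ + _ *: _).
Qed.

(* A commutator: under [x |-> 1 + c x], the last two factors are the inverses of
   the first two. *)
Lemma qop_comm c a b N1 N2 : N1 *m N1 = 0 -> N2 *m N2 = 0 ->
    N1 *m N2 *m N1 = 0 -> N2 *m N1 *m N2 = 0 ->
  qop c (qop c (a *: N1) (b *: N2)) (qop c (- a *: N1) (- b *: N2)) =
    (c * a * b) *: (N1 *m N2 - N2 *m N1).
Proof.
move=> e1 e2 e3 e4; rewrite /qop; mx_expand.
rewrite ?(e1, e2, e3, e4, mul0mx, scaler0).
rewrite -?(mulmxA N1 N2 N2) ?e2 ?mulmx0 ?scaler0.
by mx_entries; ring.
Qed.

Lemma outer_trip (u v w x : 'cV[R]_(m.*2)) :
  u *m dual v *m w *m dual x = bf v w *: (u *m dual x).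
Proof. by rewrite -mulmxA outer_mul. Qed.

(** Induction on vectors orthogonal to the hyperbolic pair of [j]. Siegel transformations are
    additive in them, which reduces claims to multiples of basis vectors. *)
Lemma ev_ind (P : 'cV[R]_(m.*2) -> Prop) (j : 'I_(m.*2)) :
    P 0 -> (forall v w, P v -> P w -> P (v + w)) ->
    (forall k f, k != j -> k != sigma0 j -> P (f *: ev R k)) ->
  forall v, v j 0 = 0 -> v (sigma0 j) 0 = 0 -> P v.
Proof.
move=> P0 PD Pev v vj vsj.
have -> : v = \sum_(k | (k != j) && (k != sigma0 j)) v k 0 *: ev R k.
  apply/matrixP=> i i'; rewrite ord1 summxE.
  have [->|ij] := eqVneq i j.
    rewrite vj big1 // => k /andP[kj _].
    by rewrite scalemxE evE eq_sym (negbTE kj) mulr0.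
  have [->|isj] := eqVneq i (sigma0 j).
    rewrite vsj big1 // => k /andP[_ kj].
    by rewrite scalemxE evE eq_sym (negbTE kj) mulr0.
  rewrite (bigD1 i) ?ij //= scalemxE evE eqxx mulr1 big1 ?addr0 // => k /andP[_ ki].
  by rewrite scalemxE evE eq_sym (negbTE ki) mulr0.
by apply: big_ind => // k /andP[]; apply: Pev.
Qed.

(** The free pair [p], [sigma0 p] is an intermediary: its two vectors pair to 1 and all other
    pairings vanish, so the bracket keeps only [u] and [w]. The other relations feed the commutator
    formulas. *)
Lemma wedge_pair u w p :
    bf u u = 0 -> bf w w = 0 -> bf u w = 0 ->
    u p 0 = 0 -> u (sigma0 p) 0 = 0 -> w p 0 = 0 -> w (sigma0 p) 0 = 0 ->
  let N1 := wedge u (ev R p) in let N2 := wedge w (ev R (sigma0 p)) in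
  [/\ N1 *m N1 = 0, N2 *m N2 = 0, N1 *m N2 *m N1 = 0, N2 *m N1 *m N2 = 0
    & N1 *m N2 - N2 *m N1 = - wedge u w].
Proof.
move=> uu ww uw up usp wp wsp N1 N2.
have pp : bf (ev R p) (ev R p) = 0 by rewrite bf_ev (negbTE (sigma0_neq _)).
have pp' : bf (ev R (sigma0 p)) (ev R (sigma0 p)) = 0.
  by rewrite bf_ev sigma0K eq_sym (negbTE (sigma0_neq _)).
have psp : bf (ev R p) (ev R (sigma0 p)) = 1 by rewrite bf_ev eqxx.
have spp : bf (ev R (sigma0 p)) (ev R p) = 1 by rewrite bfC.
have e1 : N1 *m N1 = 0.
  rewrite /N1 /wedge; mx_expand; rewrite !outer_trip uu pp bf_evl bf_evr usp.
  by mx_entries; ring.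
have e2 : N2 *m N2 = 0.
  rewrite /N2 /wedge; mx_expand.
  by rewrite !outer_trip ww pp' bf_evl bf_evr sigma0K wp; mx_entries; ring.
have e12 : N1 *m N2 = - (u *m dual w).
  rewrite /N1 /N2 /wedge; mx_expand.
  rewrite !outer_trip bf_evl wsp psp uw bf_evr sigma0K up; mx_entries; ring.
have e21 : N2 *m N1 = - (w *m dual u).
  rewrite /N1 /N2 /wedge; mx_expand.
  by rewrite !outer_trip bf_evl sigma0K up (bfC w) uw spp bf_evr wsp; mx_entries; ring.
have e3 : N1 *m N2 *m N1 = 0.
  rewrite e12 /N1 /wedge; mx_expand.
  by rewrite !outer_trip (bfC w) uw bf_evr wsp; mx_entries; ring.
have e4 : N2 *m N1 *m N2 = 0.
  rewrite e21 /N2 /wedge; mx_expand.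
  by rewrite !outer_trip uw bf_evr sigma0K up; mx_entries; ring.
by split; rewrite // e12 e21 /wedge; mx_entries; ring.
Qed.

Variable h : R.
Hypothesis h2 : 2%:R * h = 1.

(* [1 + c * siegel c j v] is the Siegel (Eichler) transformation attached to the
   isotropic vector [ev j] and to [c v]. *)
Definition siegel c (j : 'I_(m.*2)) (v : 'cV[R]_(m.*2)) : 'M[R]_(m.*2) :=
  wedge v (ev R j) - (c * (h * bf v v)) *: (ev R j *m dual (ev R j)).

Lemma siegelD c j v w : bf (ev R j) v = 0 -> bf (ev R j) w = 0 ->
  siegel c j (v + w) = qop c (siegel c j v) (siegel c j w).
Proof.
move=> jv jw; have jj : bf (ev R j) (ev R j) = 0.
  by rewrite bf_ev (negbTE (sigma0_neq _)).
(* Polarization: the quadratic term of [v + w] contributes [2 h] times [bf v w], which must match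
   the cross term of the product. *)
have vw : bf v w = h * (bf v w + bf v w).
  by rewrite -mulr2n -mulr_natl mulrA (mulrC h) h2 mul1r.
rewrite /siegel /qop /wedge dualD bfDl !bfDr; mx_expand.
rewrite !outer_trip jj jw (bfC v (ev R j)) jv (bfC w v); rewrite [in RHS]vw.
by mx_entries; ring.
Qed.

Lemma siegel_ev c j k f : siegel c j (f *: ev R k) = f *: wedge (ev R k) (ev R j).
Proof.
rewrite /siegel wedgeZl bfZl bfZr bf_ev (negbTE (sigma0_neq k)).
by rewrite !mulr0 scale0r subr0.
Qed.

Lemma tracked_siegel c y j v : v j 0 = 0 -> v (sigma0 j) 0 = 0 ->
  tracked c y (siegel c j (y *: v)).
Proof.
pose P v := bf (ev R j) v = 0 /\ tracked c y (siegel c j (y *: v)).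
suff PP w : w j 0 = 0 -> w (sigma0 j) 0 = 0 -> P w by move=> v1 v2; case: (PP v).
apply: ev_ind => [|v1 v2 [jv1 Q1] [jv2 Q2]|k f kj skj].
- split; first by rewrite bf_evl mxE.
  by rewrite scaler0 -(scale0r (ev R j)) siegel_ev scale0r; apply: tracked_zero.
- split; first by rewrite bfDr jv1 jv2 addr0.
  by rewrite scalerDr siegelD ?bfZr ?jv1 ?jv2 ?mulr0 //; apply: tracked_op.
- split; first by rewrite bfZr bf_ev eq_sym (negbTE skj) mulr0.
  by rewrite scalerA siegel_ev; apply: tracked_gen.
Qed.

Lemma siegel_isotropic c j v : bf v v = 0 -> siegel c j v = wedge v (ev R j).
Proof. by move=> vv; rewrite /siegel vv !mulr0 scale0r subr0. Qed.

(** A commutator of Siegel elements along the free pair [p], [sigma0 p], with parameters [y] and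
    [y * - f]; the modulus and the two parameters account for [c * y * y]. *)
Lemma tracked_wedge c y f p (u w : 'cV[R]_(m.*2)) :
    bf u u = 0 -> bf w w = 0 -> bf u w = 0 ->
    u p 0 = 0 -> u (sigma0 p) 0 = 0 -> w p 0 = 0 -> w (sigma0 p) 0 = 0 ->
  tracked c y ((c * y * y * f) *: wedge u w).
Proof.
move=> uu ww uw up usp wp wsp.
have Qs a b j v : bf v v = 0 -> v j 0 = 0 -> v (sigma0 j) 0 = 0 -> a = y * b ->
    tracked c y (a *: wedge v (ev R j)).
  move=> vv vj vsj ->; rewrite -wedgeZl -scalerA -(@siegel_isotropic c).
    by apply: tracked_siegel; rewrite scalemxE ?vj ?vsj mulr0.
  by rewrite !bfZl !bfZr vv !mulr0.
have [e1 e2 e3 e4 e5] := wedge_pair uu ww uw up usp wp wsp.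
have -> : (c * y * y * f) *: wedge u w = (c * y * (y * - f)) *: - wedge u w.
  by mx_entries; ring.
rewrite -e5 -(qop_comm c y (y * - f)) //.
by do 2!apply: tracked_op;
  [apply: (Qs _ 1)|apply: (Qs _ (- f))|apply: (Qs _ (- 1))|apply: (Qs _ f)];
  rewrite ?sigma0K //; ring.
Qed.

End Quasi.

(** * Conjugation by elements defined over a localization *)

Lemma exists_notin N (s : seq 'I_N) : (size s < N)%N -> exists p, p \notin s.
Proof.
move=> lt_s; have [/forallP all_s|/forallPn //] := boolP [forall p, p \in s].
have: (#|'I_N| <= #|s|)%N by apply: subset_leq_card; apply/subsetP=> p _; apply: all_s.
by rewrite card_ord leqNgt (leq_ltn_trans (card_size s)).
Qed.

Section Root.
Variables (R : comNzRingType) (m : nat).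
Implicit Types (i j k l : 'I_(m.*2)).

(* [w] times the generator with parameter [a / w]. *)
Definition root_mx (w a : R) i j : 'M[R]_(m.*2) :=
  w%:M + a *: wedge (ev R i) (ev R j).

Lemma star_root_mx w a i j : star (root_mx w a i j) = root_mx w (- a) i j.
Proof.
by rewrite /root_mx starD starZ star_wedge -scalemx1 starZ star1 scalerN scaleNr.
Qed.

Variables (w a : R) (i j : 'I_(m.*2)).
Hypothesis isj : i != sigma0 j.
Let M := root_mx w a i j.

Lemma wedge_sq : wedge (ev R i) (ev R j) *m wedge (ev R i) (ev R j) = 0.
Proof.
rewrite /wedge; mx_expand; rewrite !outer_trip !bf_ev.
rewrite (sigma0_eqC i j) (eq_sym (sigma0 j)) (negbTE isj).
by rewrite !(negbTE (sigma0_neq _)); mx_entries; rewrite /= mulr0n; ring.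
Qed.

Lemma root_mxM b : root_mx w b i j *m root_mx w (- b) i j = (w * w)%:M.
Proof.
rewrite /root_mx mulmxDl !mulmxDr -scalar_mxM mul_scalar_mx mul_mx_scalar.
rewrite -!scalemxAl -!scalemxAr wedge_sq !scaler0 addr0 -addrA.
by rewrite !scalerA mulrN mulrC scaleNr addNr addr0.
Qed.

Lemma root_mx_star : M *m star M = (w * w)%:M.
Proof. by rewrite star_root_mx root_mxM. Qed.

Lemma star_root_mxM : star M *m M = (w * w)%:M.
Proof. by have := root_mxM (- a); rewrite opprK star_root_mx. Qed.

Lemma root_ev k : star M *m ev R k =
  w *: ev R k - a *: ((sigma0 j == k)%:R *: ev R i - (sigma0 i == k)%:R *: ev R j).
Proof.
rewrite star_root_mx /root_mx mulmxDl mul_scalar_mx -scalemxAl scaleNr.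
by rewrite /wedge mulmxBl -!mulmxA !dual_mul !mul_mx_scalar !bf_ev.
Qed.

Variable h : R.
Hypotheses (h2 : 2%:R * h = 1) (hm : (4 <= m)%N).

(** [star M] scales [ev R k] by [w] unless [k] is [sigma0 i] or [sigma0 j]. In the exceptional case
    the two images lie in at most three hyperbolic pairs, and [4 <= m] leaves a fourth free for
    [tracked_wedge]. *)
Lemma root_tracked c y t (x : 'M[R]_(m.*2)) : tracked (c * (w * w)) (c * y * y * t) x ->
  tracked c y (star M *m x *m M).
Proof.
elim=> [|x1 x2 _ Q1 _ Q2|k l f kl skl].
- by rewrite mulmx0 mul0mx; apply: tracked_zero.
- by rewrite (qop_star _ _ _ root_mx_star); apply: tracked_op.
rewrite -scalemxAr -scalemxAl wedge_conj.
have [hit|] := boolP ((k \in [:: sigma0 i; sigma0 j]) || (l \in [:: sigma0 i; sigma0 j])).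
  rewrite -mulrA.
  have bfM u v : bf (star M *m u) (star M *m v) = (w * w) * bf u v.
    by rewrite bfMl mulmxA root_mx_star mul_scalar_mx bfZr.
  (* [q] is the companion of the index that hits [sigma0 i] or [sigma0 j]. *)
  have [q qP] : exists q, {subset [:: k; l] <= [:: sigma0 i; sigma0 j; q]}.
    case/orP: hit => hit; [exists l | exists k] => r; rewrite !inE;
    by case/orP=> /eqP->; move: hit; rewrite ?inE ?eqxx ?orbT // => /orP[]->; rewrite ?orbT.
  have [|p] := @exists_notin _ [:: i; sigma0 i; j; sigma0 j; q; sigma0 q].
    by move: hm => /=; clear; lia.
  rewrite !inE !negb_or => /and5P[pi psi pj psj /andP[pq psq]].
  have npkl r : r \in [:: k; l] -> (p != r) && (sigma0 p != r).
    move/qP; rewrite !inE sigma0_eqC => /or3P[]/eqP->; rewrite ?sigma0K.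
    - by rewrite psi pi.
    - by rewrite psj pj.
    - by rewrite pq psq.
  have coord r : r \in [:: k; l] ->
      (star M *m ev R r) p 0 = 0 /\ (star M *m ev R r) (sigma0 p) 0 = 0.
    move/npkl/andP=> [pr spr].
    rewrite root_ev ?(addmxE, oppmxE, scalemxE) !evE (negbTE pi) (negbTE pj).
    rewrite (negbTE pr) (negbTE spr) !sigma0_eqC (negbTE psi) (negbTE psj).
    by rewrite /= !mulr0n; split; ring.
  have [|kp ksp] := coord k; first by rewrite !inE eqxx.
  have [|lp lsp] := coord l; first by rewrite !inE eqxx orbT.
  apply: (@tracked_wedge _ _ h h2 _ _ _ p); rewrite // bfM bf_ev ?(negbTE (sigma0_neq _)) ?mulr0 //.
  by rewrite sigma0_eqC (negbTE skl) mulr0.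
rewrite !inE !negb_or => /andP[/andP[ki kj] /andP[li lj]].
rewrite !root_ev !(eq_sym (sigma0 _)) (negbTE ki) (negbTE kj) (negbTE li) (negbTE lj).
rewrite !scale0r subrr scaler0 !subr0 wedgeZl wedgeZr !scalerA.
have -> : c * y * y * t * f * w * w = y * (c * y * t * f * w * w) by ring.
exact: tracked_gen.
Qed.

End Root.

(** * Block extension and its conjugation by a root element *)

Section Extension.
Variables (R : comNzRingType) (n m : nat).
Hypothesis hnm : (n <= m)%N.
Implicit Types (i j : 'I_(m.*2)) (x : 'M[R]_(n.*2)).

Definition V1 : 'M[R]_(n.*2, m.*2) := \matrix_(i, j) (i == j :> nat)%:R.

Definition ext x : 'M[R]_(m.*2) := star V1 *m x *m V1.

Lemma V1_star : V1 *m star V1 = 1%:M.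
Proof.
apply/matrixP=> i j; rewrite mxE.
have le2 : (n.*2 <= m.*2)%N by rewrite leq_double.
rewrite (bigD1 (widen_ord le2 i)) //= big1 ?addr0.
  by rewrite starE !mxE eqxx mul1r -[in RHS](sigma0_eq i j) -val_eqE /= eq_sym.
move=> k ki; rewrite mxE; case: eqP => [ik|_]; last by rewrite mul0r.
by case/negP: ki; rewrite -val_eqE /= ik.
Qed.

Lemma V1_ev j : (n.*2 <= j)%N -> V1 *m ev R j = 0.
Proof.
move=> nj; apply/matrixP=> i k; rewrite ord1 -colE !mxE.
case: eqP => // ij; have := leq_trans (ltn_ord i) nj.
by rewrite ij ltnn.
Qed.

Lemma ext_ev j x : (n.*2 <= j)%N -> ext x *m ev R j = 0.
Proof. by move=> nj; rewrite /ext -mulmxA V1_ev ?mulmx0. Qed.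

Lemma extM x x' : ext x *m ext x' = ext (x *m x').
Proof.
by rewrite /ext !mulmxA -(mulmxA _ V1 (star V1)) V1_star mulmx1.
Qed.

Lemma extD x x' : ext (x + x') = ext x + ext x'.
Proof. by rewrite /ext mulmxDr mulmxDl. Qed.
Lemma extZ a x : ext (a *: x) = a *: ext x.
Proof. by rewrite /ext -scalemxAr -scalemxAl. Qed.
Lemma ext0 : ext 0 = 0.
Proof. by rewrite /ext mulmx0 mul0mx. Qed.
Lemma star_ext x : star (ext x) = ext (star x).
Proof. by rewrite /ext !starM starK mulmxA. Qed.

Lemma dual_ext j x : (n.*2 <= j)%N -> dual (ev R j) *m ext x = 0.
Proof.
move=> nj; rewrite -dualMl star_ext ext_ev //.
by apply/matrixP=> i k; rewrite ord1 dualE !mx0E.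
Qed.

(* [(1 + c x) star (1 + c x) = 1] with a factor [c] cancelled. *)
Definition qorth c x : Prop := x + star x + c *: (x *m star x) = 0.

(** Put [G = 1 + c w^2 z ext x] and let [L] be the root matrix over [w]. Then
    [L^-1 G L = G (G^-1 L^-1 G L)]. As [G] fixes [ev R j], the second factor is the Siegel
    transformation along [ev R j] for [-(a / w) (star G - 1) ev R i], which is [c z v]. *)
Lemma root_ext (h w a c z : R) i j x : 2%:R * h = 1 -> i != sigma0 j ->
  (n.*2 <= j)%N -> qorth (c * (w * w) * z) x ->
  exists v, star (root_mx w a i j) *m (z *: ext x) *m root_mx w a i j =
     qop c ((w * w * z) *: ext x) (siegel h c j (z *: v)) /\
     (v j 0 = 0 /\ v (sigma0 j) 0 = 0).
Proof.
move=> h2 isj nj ox; set E := ext x; set C := c * (w * w) * z in ox.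
have oE : E + star E + C *: (E *m star E) = 0.
  by rewrite star_ext extM -extZ -!extD ox ext0.
have CEE : C *: (E *m star E) = - (E + star E).
  by apply/eqP; rewrite -addr_eq0 addrC oE.
exists (- (w * a) *: (star E *m ev R i)); split; last first.
  have coord (k : 'I_(m.*2)) : (n.*2 <= k)%N -> (star E *m ev R i) k 0 = 0.
    move=> nk; rewrite -[k]sigma0K -bf_evl bfC bfMl ext_ev.
      by rewrite /bf mulmx0 mxE.
    by rewrite leqNgt sigma0_lt -leqNgt.
  rewrite !scalemxE !coord ?mulr0 //.
  by rewrite leqNgt sigma0_lt -leqNgt.
set v := z *: (- _ *: _).
have Ej : E *m ev R j = 0 by apply: ext_ev.
have jE : dual (ev R j) *m E = 0 by apply: dual_ext.
have vE : v + C *: (E *m v) = (w * a * z) *: (E *m ev R i).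
  rewrite /v scalerA -scalemxAr (scalerA C) (mulrC C) -(scalerA _ C) -scalerDr.
  rewrite mulmxA (scalemxAl C) CEE mulNmx mulmxDl opprD addrCA subrr addr0.
  by rewrite scalerN -scaleNr; congr (_ *: _); ring.
have dv : dual v = - (w * a * z) *: (dual (ev R i) *m E).
  by rewrite /v !dualZ dualMl scalerA; congr (_ *: _); ring.
(* The factor [h] cancels: [C *: (E *m star E)] is [- (E + star E)], and both summands give the same
   value on [ev R i]. *)
have vv : c * (h * bf v v) = - (a * a * z) * bf (ev R i) (E *m ev R i).
  rewrite /v !bfZl !bfZr bfMl mulmxA.
  have -> : c * (h * (z * (- (w * a) * (z * (- (w * a) * bf (ev R i) (E *m star E *m ev R i))))))
    = h * a * a * z * bf (ev R i) ((C *: (E *m star E)) *m ev R i).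
    by rewrite -scalemxAl bfZr /C; ring.
  rewrite CEE mulNmx -scaleN1r bfZr mulmxDl bfDr (bfC _ (star E *m _)) bfMl.
  by transitivity (- (a * a * z) * (2%:R * h * bf (ev R i) (E *m ev R i))); [ring|rewrite h2 mul1r].
rewrite star_root_mx /root_mx /siegel vv.
have -> (e : 'M[R]_(m.*2)) : qop c ((w * w * z) *: E) e = (w * w * z) *: E + (e + C *: (E *m e)).
  by rewrite /qop /C -scalemxAl scalerA addrA mulrA.
have -> (b : R) : wedge v (ev R j) - b *: (ev R j *m dual (ev R j)) +
   C *: (E *m (wedge v (ev R j) - b *: (ev R j *m dual (ev R j)))) =
   (w * a * z) *: (E *m ev R i *m dual (ev R j)) - ev R j *m dual v
     - b *: (ev R j *m dual (ev R j)).
  rewrite (scalemxAl (w * a * z)) -vE /wedge; mx_expand; rewrite Ej; mx_expand.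
  by mx_entries; ring.
clearbody v E; rewrite dv /wedge -(scalemx1 _ w); mx_expand.
rewrite -!(mulmxA _ E (ev R j)) Ej -!(mulmxA _ (dual (ev R j)) E) jE.
rewrite -!(mulmxA _ E (ev R i)); mx_expand; rewrite -!(mulmxA _ E (ev R i)) outer_trip.
by mx_entries; ring.
Qed.
End Extension.

Lemma scalar_comm (R : comNzRingType) k (w a b : R) (N1 N2 : 'M[R]_k) :
    N1 *m N1 = 0 -> N2 *m N2 = 0 -> N1 *m N2 *m N1 = 0 -> N2 *m N1 *m N2 = 0 ->
  (w%:M + a *: N1) *m (w%:M + b *: N2) *m (w%:M + (- a) *: N1) *m (w%:M + (- b) *: N2) =
    (w * w * w * w)%:M + (w * w * a * b) *: (N1 *m N2 - N2 *m N1).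
Proof.
move=> e1 e2 e3 e4.
have -> : (w%:M + a *: N1) *m (w%:M + b *: N2) *m (w%:M + (- a) *: N1) =
    (w * w) *: (w%:M + b *: N2) + (w * a * b) *: (N1 *m N2 - N2 *m N1).
  rewrite -(scalemx1 _ w); mx_expand; rewrite e1 e3; mx_expand.
  by mx_entries; ring.
rewrite -(scalemx1 _ w) -(scalemx1 _ (w * w * w * w)); mx_expand.
rewrite -(mulmxA N1 N2 N2) e2 e4; mx_expand.
by mx_entries; ring.
Qed.

(** * Denominators, admissible elements and reachable matrices *)

Section DividesPower.
Variable R : comNzRingType.
Implicit Types s t a b : R.

(** Equivalently, [a] is a unit in the localization at [s]. *)
Definition dvp s a := exists d k, a * d = s ^+ k.

Lemma dvp1 s : dvp s 1.
Proof. by exists 1, 0; rewrite mulr1. Qed.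

Lemma dvpM s a b : dvp s a -> dvp s b -> dvp s (a * b).
Proof.
move=> [d [k e]] [d' [k' e']]; exists (d * d'), (k + k').
by rewrite exprD -e -e'; ring.
Qed.

Lemma dvp_dvd s a b : dvp s (a * b) -> dvp s a.
Proof. by move=> [d [k e]]; exists (b * d), k; rewrite mulrA. Qed.

Lemma dvp_mulr s t a : dvp s a -> dvp (s * t) a.
Proof. by move=> [d [k e]]; exists (d * t ^+ k), k; rewrite mulrA e exprMn. Qed.

Definition dvdr a b := exists d, b = a * d.
End DividesPower.

Section Admissible.
Variables (R : comNzRingType) (h : R).
Hypothesis h2 : 2%:R * h = 1.
Variables (n m : nat).
Hypotheses (hm : (4 <= m)%N) (hnm : (n < m)%N).
Let le_nm := ltnW hnm.

Definition conj_tracked c y z (mu : R) (M : 'M[R]_(m.*2)) := forall x,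
  tracked (c * (mu * mu)) z x -> tracked c y (star M *m x *m M).

(** Conjugation by [M / mu] changes the extended element only by a factor [1 + c e] on the right,
    with [e] tracked over [R] itself. *)
Definition conj_ext c y z (mu : R) (M : 'M[R]_(m.*2)) := forall x : 'M[R]_(n.*2),
  qorth (c * (mu * mu) * z) x -> exists2 e, tracked c y e &
    star M *m (z *: ext m x) *m M = qop c ((mu * mu * z) *: ext m x) e.

(* [M / mu] is an elementary orthogonal matrix over the localization at [s];
   conjugation by it preserves integrality of elements that are sufficiently
   divisible by [s]. *)
Definition adm (s mu : R) (M : 'M[R]_(m.*2)) :=
  [/\ dvp s mu, M *m star M = (mu * mu)%:M, star M *m M = (mu * mu)%:M &
    exists N, forall c y z, dvdr ((s * c * y) ^+ N) z ->
      conj_tracked c y z mu M /\ conj_ext c y z mu M].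

Lemma adm1 s : adm s 1 1%:M.
Proof.
split; rewrite ?star1 ?mulmx1 ?mulr1 //; first exact: dvp1.
exists 1 => c y z [d ->]; rewrite expr1; split=> x.
  rewrite !mulr1 star1 mul1mx mulmx1.
  have -> : s * c * y * d = y * (s * c * d) by ring.
  exact: tracked_weaken.
move=> _; exists 0; first exact: tracked_zero.
by rewrite !mulr1 mul1r star1 mul1mx mulmx1 qop0.
Qed.

(** Conjugate by the root first, then by [M]. The root turns an extended element into itself times a
    Siegel element, and [M] treats the two factors separately. *)
Lemma adm_root s w a (i j : 'I_(m.*2)) mu M : i != j -> i != sigma0 j ->
  (n.*2 <= j)%N -> dvp s w -> adm s mu M -> adm s (w * mu) (root_mx w a i j *m M).
Proof.
move=> ij isj nj sw [smu MM1 MM2 [N NP]]; set L := root_mx w a i j.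
have ww : (w * mu) * (w * mu) = (w * w) * (mu * mu) by ring.
split; first exact: dvpM.
- rewrite starM mulmxA -(mulmxA L) MM1 mul_mx_scalar -scalemxAl.
  by rewrite root_mx_star // scale_scalar_mx ww mulrC.
- rewrite starM mulmxA -(mulmxA _ (star L)) star_root_mxM // mul_mx_scalar -scalemxAl.
  by rewrite MM2 scale_scalar_mx ww.
have [d [k mud]] := smu.
(* [N + N] supplies two factors [y1] for the commutators, [k + k] supplies [mu * mu], and the extra
   one supplies [c]. *)
exists (N + N + (k + k).+1)%N => c y z [t tz]; set y1 := (s * c * y) ^+ N.
have [u zu] : exists u, z = (c * (mu * mu)) * y1 * y1 * u.
  exists (d * d * c ^+ (k + k) * y ^+ (k + k) * s * y * t).
  by rewrite tz /y1 !(exprD, exprS) !exprMn -mud; ring.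
have [NQ Next] : conj_tracked c y y1 mu M /\ conj_ext c y (w * w * z) mu M.
  split; first by case: (NP c y y1) => //; exists 1; rewrite mulr1.
  case: (NP c y (w * w * z)) => //; exists (w * w * c * (mu * mu) * y1 * u).
  by rewrite zu -/y1; ring.
have wconj x : star (L *m M) *m x *m (L *m M) = star M *m (star L *m x *m L) *m M.
  by rewrite starM !mulmxA.
split=> x.
  rewrite wconj => Qx; apply: NQ.
  apply: (@root_tracked _ _ w a i j isj h h2 hm _ _ u); rewrite -zu.
  by have <- : c * (w * mu * (w * mu)) = c * (mu * mu) * (w * w) by ring.
move=> ox; have ox' : qorth (c * (mu * mu) * (w * w) * z) x.
  by have -> : c * (mu * mu) * (w * w) * z = c * (w * mu * (w * mu)) * z by ring.
have [v [ev [v1 v2]]] := root_ext le_nm a h2 isj nj ox'.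
have [|e Qe ee] := Next x; first by rewrite !mulrA in ox' *.
exists (qop c e (star M *m siegel h (c * (mu * mu)) j (z *: v) *m M)).
  apply: tracked_op => //; apply: NQ.
  have -> : z = y1 * (c * (mu * mu) * y1 * u) by rewrite zu; ring.
  by rewrite -scalerA; apply: (tracked_siegel h2); rewrite scalemxE ?v1 ?v2 mulr0.
rewrite wconj ev (qop_star _ _ _ MM1) ee qopA.
by have -> : w * mu * (w * mu) * z = mu * mu * (w * w * z) by ring.
Qed.

Lemma adm_mulr s t mu M : adm s mu M -> adm (s * t) mu M.
Proof.
move=> [smu MM1 MM2 [N NP]]; split=> //; first exact: dvp_mulr.
exists N => c y z [d zd]; apply: NP; exists (t ^+ N * d).
by rewrite zd !exprMn; ring.
Qed.

Variable V : 'M[R]_(n.*2, m.*2).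

(* [U / k] is obtained from [V] by elementary operations over the localization
   at [s]; multiplying by [t] absorbs the [s]-torsion. *)
Definition reach s k (U : 'M[R]_(n.*2, m.*2)) :=
  dvp s k /\ exists t, [/\ dvp s t,
    (t *: U) *m star (t *: U) = (t * k * (t * k))%:M &
    exists M mu, adm s mu M /\ (t *: U) *m M = (t * k * mu) *: V].

Lemma reach0 s : V *m star V = 1%:M -> reach s 1 V.
Proof.
move=> VV; split; first exact: dvp1.
exists 1; split; rewrite ?scale1r ?mulr1 //; first exact: dvp1.
by exists 1%:M, 1; split; [apply: adm1 | rewrite mulmx1 !mulr1 scale1r].
Qed.

Lemma reach_mulr s t k U : reach s k U -> reach (s * t) k U.
Proof.
move=> [sk [r [sr UU [M [mu [aM UM]]]]]]; split; first exact: dvp_mulr.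
exists r; split=> //; first exact: dvp_mulr.
by exists M, mu; split=> //; apply: adm_mulr.
Qed.

Lemma reach_scale s r k U : dvp s r -> reach s k U -> reach s (r * k) (r *: U).
Proof.
move=> sr [sk [t [st UU [M [mu [aM UM]]]]]]; split; first exact: dvpM.
have tr : t *: (r *: U) = r *: (t *: U) by rewrite !scalerA mulrC.
exists t; split; rewrite // tr.
  rewrite starZ -scalemxAl -scalemxAr UU !scale_scalar_mx.
  by congr (_%:M); ring.
exists M, mu; split; rewrite // -scalemxAl UM scalerA.
by congr (_ *: _); ring.
Qed.

(** The common factor moves into the multiplier [t], so nothing has to be cancelled in [R]. *)
Lemma reach_descale s r k U : dvp s r -> reach s (r * k) (r *: U) -> reach s k U.
Proof.
move=> sr [srk [t [st UU [M [mu [aM UM]]]]]].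
split; first by apply: (@dvp_dvd _ s k r); rewrite mulrC.
move: UU UM; rewrite scalerA !mulrA => UU UM.
exists (t * r); split; rewrite ?UU ?mulrA //; first exact: dvpM.
by exists M, mu; split.
Qed.

Lemma reach_root_outer s w a (i j : 'I_(m.*2)) k U :
    i != j -> i != sigma0 j -> (n.*2 <= j)%N -> dvp s w ->
  reach s k U -> reach s (w * k) (U *m root_mx w a i j).
Proof.
move=> ij isj nj sw [sk [t [st UU [M [mu [aM UM]]]]]]; split; first exact: dvpM.
exists t; split=> //.
  rewrite scalemxAl starM mulmxA -(mulmxA _ (root_mx _ _ _ _)) root_mx_star //.
  rewrite mul_mx_scalar -scalemxAl UU scale_scalar_mx.
  by congr (_%:M); ring.
exists (root_mx w (- a) i j *m M), (w * mu); split; first exact: adm_root.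
rewrite scalemxAl !mulmxA -(mulmxA _ (root_mx w a i j)) root_mxM //.
rewrite mul_mx_scalar -scalemxAl UM scalerA.
by congr (_ *: _); ring.
Qed.

Lemma root_mxC w (a : R) (i j : 'I_(m.*2)) : root_mx w a i j = root_mx w (- a) j i.
Proof. by rewrite /root_mx wedgeC scaleNr scalerN. Qed.

Lemma outer_lt : (n.*2 < m.*2)%N. Proof. by rewrite ltn_double. Qed.

Definition first_outer : 'I_(m.*2) := Ordinal outer_lt.

Lemma outer_sigma0 (i : 'I_(m.*2)) : (n.*2 <= sigma0 i)%N = (n.*2 <= i)%N.
Proof. by rewrite leqNgt sigma0_lt -leqNgt. Qed.

(** A root with both indices inner is a commutator of roots through the pair of [first_outer]; the
    four factors leave an excess scalar [w ^ 3], removed by [reach_descale]. *)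
Lemma reach_root s w a (i j : 'I_(m.*2)) k U :
    i != j -> i != sigma0 j -> dvp s w ->
  reach s k U -> reach s (w * k) (U *m root_mx w a i j).
Proof.
move=> ij isj sw rU.
have [nj|jn] := leqP n.*2 j; first exact: reach_root_outer.
have [ni|ltin] := leqP n.*2 i.
  rewrite root_mxC; apply: reach_root_outer => //; first by rewrite eq_sym.
  by rewrite eq_sym sigma0_eqC.
set p := first_outer.
have inner_p (l : 'I_(m.*2)) : (l < n.*2)%N -> l != p /\ l != sigma0 p.
  by move=> ln; split; apply: contraTneq ln => ->; rewrite ?sigma0_lt /= ltnn.
have [ip isp] := inner_p i ltin; have [jp jsp] := inner_p j jn.
have ev0 (l q : 'I_(m.*2)) : q != l -> (ev R q) l 0 = 0.
  by rewrite evE eq_sym => /negbTE->.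
have iso (l : 'I_(m.*2)) : bf (ev R l) (ev R l) = 0 by rewrite bf_ev (negbTE (sigma0_neq l)).
have ij0 : bf (ev R i) (ev R j) = 0 by rewrite bf_ev sigma0_eqC (negbTE isj).
have [e1 e2 e3 e4 e5] := wedge_pair (iso i) (iso j) ij0 (ev0 _ _ ip) (ev0 _ _ isp)
  (ev0 _ _ jp) (ev0 _ _ jsp).
set N1 := wedge (ev R i) (ev R p) in e1 e2 e3 e4 e5.
set N2 := wedge (ev R j) (ev R (sigma0 p)) in e1 e2 e3 e4 e5.
apply: (@reach_descale _ (w * w * w)); first by apply: dvpM => //; apply: dvpM.
have -> : w * w * w * (w * k) = w * (w * (w * (w * k))) by ring.
have -> : (w * w * w) *: (U *m root_mx w a i j) =
    U *m root_mx w w i p *m root_mx w (- a) j (sigma0 p)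
      *m root_mx w (- w) i p *m root_mx w a j (sigma0 p).
  rewrite -!(mulmxA U) -{3}(opprK a) /root_mx (scalar_comm _ _ _ e1 e2 e3 e4) e5.
  by rewrite scalemxAr scalerDr scale_scalar_mx mulrN scaleNr scalerN opprK scalerA.
by do 4!(apply: reach_root_outer => //; rewrite ?sigma0K ?outer_sigma0 /= //).
Qed.

(* [w ^ 2] times the Siegel transformation attached to [v / w]. *)
Definition eichler (w : R) (j : 'I_(m.*2)) (v : 'cV[R]_(m.*2)) : 'M[R]_(m.*2) :=
  (w * w)%:M + w *: wedge v (ev R j) - (h * bf v v) *: (ev R j *m dual (ev R j)).

Lemma eichlerM w j v v' : bf (ev R j) v = 0 -> bf (ev R j) v' = 0 ->
  eichler w j v *m eichler w j v' = (w * w) *: eichler w j (v + v').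
Proof.
move=> jv jw; have jj : bf (ev R j) (ev R j) = 0.
  by rewrite bf_ev (negbTE (sigma0_neq _)).
have vw : bf v v' = h * (bf v v' + bf v v').
  by rewrite -mulr2n -mulr_natl mulrA (mulrC h) h2 mul1r.
rewrite /eichler -(scalemx1 _ (w * w)) /wedge dualD bfDl !bfDr; mx_expand.
rewrite !outer_trip jj jw (bfC v (ev R j)) jv (bfC v' v); rewrite [in LHS]vw.
by mx_entries; ring.
Qed.

(** By additivity up to [w * w], an Eichler matrix splits into those of multiples of basis vectors,
    which are scaled roots. *)
Lemma reach_eichler s w (j : 'I_(m.*2)) (v : 'cV_(m.*2)) k U :
    v j 0 = 0 -> v (sigma0 j) 0 = 0 -> dvp s w ->
  reach s k U -> reach s (w * w * k) (U *m eichler w j v).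
Proof.
move=> vj vsj sw; move: k U.
pose P (v : 'cV[R]_(m.*2)) := bf (ev R j) v = 0 /\ forall k U,
  reach s k U -> reach s (w * w * k) (U *m eichler w j v).
suff: P v by case.
move: v vj vsj; apply: ev_ind => [|v v' [jv Pv] [jv' Pv']|i f ij isj].
- split=> [|k U rU]; first by rewrite bf_evl mxE.
  have -> : eichler w j 0 = (w * w)%:M.
    rewrite /eichler -(scale0r (ev R j)) wedgeZl bfZl !scale0r mul0r mulr0 scale0r.
    by rewrite scaler0 addr0 subr0.
  by rewrite mul_mx_scalar; apply: reach_scale => //; apply: dvpM.
- split=> [|k U rU]; first by rewrite bfDr jv jv' addr0.
  apply: (@reach_descale _ (w * w)); first exact: dvpM.
  by rewrite scalemxAr -eichlerM // mulmxA; apply: Pv'; apply: Pv.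
split=> [|k U rU]; first by rewrite bfZr bf_ev eq_sym (negbTE isj) mulr0.
have -> : eichler w j (f *: ev R i) = w *: root_mx w f i j.
  rewrite /eichler bfZl bfZr bf_ev (negbTE (sigma0_neq i)) !mulr0 scale0r subr0.
  by rewrite /root_mx wedgeZl -(scale_scalar_mx _ w w) -scalerDr.
by rewrite -mulrA -scalemxAr; apply: reach_scale => //; apply: reach_root.
Qed.

End Admissible.

(** * Quillen patching *)

Section Transport.
Variables (R : comNzRingType) (n m : nat) (V : 'M[R]_(n.*2, m.*2)).
Hypothesis VV : V *m star V = 1%:M.
Implicit Types g : 'M[R]_(n.*2).

(* [g] acting on the hyperbolic summand spanned by the rows of [V], extended by
   the identity of the orthogonal complement. *)
Definition transport g : 'M[R]_(m.*2) := 1%:M + star V *m (g - 1%:M) *m V.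

Lemma transport1 : transport 1%:M = 1%:M.
Proof. by rewrite /transport subrr mulmx0 mul0mx addr0. Qed.

Lemma transportM g g' : transport (g *m g') = transport g *m transport g'.
Proof.
rewrite /transport; mx_expand; rewrite -!(mulmxA _ V (star V)) VV; mx_expand.
by mx_entries; ring.
Qed.

Lemma star_transport g : star (transport g) = transport (star g).
Proof. by rewrite /transport starD star1 !starM starK starD starN star1 mulmxA. Qed.

Lemma mul_transport g : V *m transport g = g *m V.
Proof.
rewrite /transport mulmxDr mulmx1 !mulmxA VV mul1mx mulmxBl mul1mx.
by rewrite addrCA subrr addr0.
Qed.

End Transport.

Section ElementaryGroup.
Variables (R : comNzRingType) (m : nat).

Lemma is_inverseM k (A A' B B' : 'M[R]_k) :
  is_inverse A A' -> is_inverse B B' -> is_inverse (A *m B) (B' *m A').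
Proof.
move=> [a1 a2] [b1 b2]; split.
  by rewrite mulmxA -(mulmxA A) b1 mulmx1.
by rewrite mulmxA -(mulmxA B') a2 mulmx1.
Qed.

Lemma is_inverse_sym k (A B : 'M[R]_k) : is_inverse A B -> is_inverse B A.
Proof. by case. Qed.

Lemma is_inverse_uniq k (A B C : 'M[R]_k) : is_inverse A B -> is_inverse A C -> B = C.
Proof. by move=> [_ BA1] [AC1 _]; rewrite -[B]mulmx1 -AC1 mulmxA BA1 mul1mx. Qed.

Lemma oe_inverse (i j : 'I_(m.*2)) (z : R) : i != j -> is_inverse (oe i j z) (oe i j (- z)).
Proof.
move=> ij; have inv (b : R) : oe i j b *m oe i j (- b) = 1%:M.
  rewrite !oe_wedge.
  have := @root_mxM _ _ (1 : R) i (sigma0 j) _ b; rewrite /root_mx mulr1.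
  by apply; rewrite sigma0K.
by split; rewrite ?inv // -{2}(opprK z) inv.
Qed.

Lemma EO_inverse (A : 'M[R]_(m.*2)) : EO A -> exists2 B, EO B & is_inverse A B.
Proof.
move=> EA; have [B AB] : exists B, is_inverse A B.
  elim: A / EA => [A [i [j [z [ij _ ->]]]]||A A' _ [B AB] _ [B' AB']|A B _ _ AB].
  - by exists (oe i j (- z)); apply: oe_inverse.
  - by exists 1%:M; split; rewrite mulmx1.
  - by exists (B' *m B); apply: is_inverseM.
  - by exists A; apply: is_inverse_sym.
by exists B => //; apply: generated_inv AB.
Qed.

End ElementaryGroup.

(** * Extended orthogonal matrices normalize the elementary group *)

Section Normality.
Variables (R : comNzRingType) (h : R) (n m : nat).
Hypotheses (h2 : 2%:R * h = 1) (hnm : (n < m)%N).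
Variable g : 'M[R]_(n.*2).
Hypotheses (gg1 : g *m star g = 1%:M) (gg2 : star g *m g = 1%:M).

Let V1 := V1 R n m.
Let V1V1 : V1 *m star V1 = 1%:M := V1_star R (ltnW hnm).

Lemma transport_ext x : transport V1 x = 1%:M + ext m (x - 1%:M). Proof. by []. Qed.

(** [G] fixes the outer basis vectors. A generator with an outer index becomes a Siegel
    transformation; one with two inner indices becomes a wedge of vectors missing the pair of
    [first_outer], hence a commutator. *)
Lemma EO_conj (A : 'M[R]_(m.*2)) : EO A -> EO (transport V1 (star g) *m A *m transport V1 g).
Proof.
set G := transport V1 g; have sG : transport V1 (star g) = star G by rewrite star_transport.
have GG1 : G *m star G = 1%:M by rewrite -sG -transportM // gg1 transport1.
have GG2 : star G *m G = 1%:M by rewrite -sG -transportM // gg2 transport1.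
rewrite sG; elim=> {A} [A [i [l [z [il isl ->]]]]||A A' _ EA _ EA'|A B _ EA [AB BA]].
- rewrite oe_wedge mulmxDr mulmxDl mulmx1 GG2 -scalemxAr -scalemxAl wedge_conj.
  have bfG u v : bf (star G *m u) (star G *m v) = bf u v.
    by rewrite bfMl mulmxA GG1 mul1mx.
  have iso (k : 'I_(m.*2)) : bf (ev R k) (ev R k) = 0 by rewrite bf_ev (negbTE (sigma0_neq k)).
  have fixG (k : 'I_(m.*2)) : (n.*2 <= k)%N ->
      star G *m ev R k = ev R k /\ G *m ev R k = ev R k.
    by move=> nk; rewrite -sG /G !transport_ext ![(1%:M + _) *m _]mulmxDl !mul1mx !ext_ev // !addr0.
  have coord (q k : 'I_(m.*2)) : (n.*2 <= q)%N -> q != k -> (star G *m ev R k) q 0 = 0.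
    move=> nq qk; rewrite -[q]sigma0K -bf_evl bfC bfMl.
    rewrite (proj2 (fixG _ _)) ?outer_sigma0 // bf_evl evE.
    by rewrite sigma0_eq eq_sym (negbTE qk).
  have EOw (k k' : 'I_(m.*2)) : (n.*2 <= k')%N -> k != k' -> k != sigma0 k' -> forall z,
      EO (1%:M + z *: wedge (star G *m ev R k) (star G *m ev R k')).
    move=> nk kk skk z'; rewrite (proj1 (fixG k' nk)) -wedgeZl.
    rewrite -(@siegel_isotropic _ _ h 1); last by rewrite bfZl bfZr bfG iso !mulr0.
    apply: (@tracked_EO _ _ z'); apply: (tracked_siegel h2); apply: coord; rewrite ?outer_sigma0 //.
      by rewrite eq_sym.
    by rewrite eq_sym.
  have il' : i != sigma0 (sigma0 l) by rewrite sigma0K.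
  move: (sigma0 l) isl il' => k ik isk.
  have [nk|kn] := leqP n.*2 k; first exact: EOw.
  have [ni|ltin] := leqP n.*2 i.
    rewrite wedgeC scalerN -scaleNr; apply: EOw; rewrite // eq_sym //.
    by rewrite sigma0_eqC.
  set p := first_outer hnm.
  have np : (n.*2 <= p)%N by [].
  have inner_p (q : 'I_(m.*2)) : (q < n.*2)%N -> p != q /\ sigma0 p != q.
    by move=> qn; split; apply: contraTneq qn => <-; rewrite ?sigma0_lt /= ltnn.
  have [pi spi] := inner_p i ltin; have [pk spk] := inner_p k kn.
  apply: (@tracked_EO _ _ 1); have -> : z = 1 * 1 * 1 * z by rewrite !mul1r.
  apply: (@tracked_wedge _ _ h h2 1 1 z p); rewrite ?bfG ?iso //.
  - by rewrite bf_ev sigma0_eqC (negbTE isk).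
  - exact: coord.
  - by apply: coord; rewrite ?outer_sigma0.
  - exact: coord.
  - by apply: coord; rewrite ?outer_sigma0.
- by rewrite mulmx1 GG2; apply: generated_one.
- have -> : star G *m (A *m A') *m G = (star G *m A *m G) *m (star G *m A' *m G).
    by rewrite !mulmxA -(mulmxA _ G (star G)) GG1 mulmx1.
  exact: generated_mul.
apply: generated_inv EA _; split; rewrite !mulmxA -(mulmxA _ G (star G)) GG1 mulmx1.
  by rewrite -(mulmxA _ A) AB mulmx1.
by rewrite -(mulmxA _ B) BA mulmx1.
Qed.

End Normality.

Section Patching.
Variables (R : comNzRingType) (h : R) (n m : nat) (V : 'M[R]_(n.*2, m.*2)).
Hypotheses (h2 : 2%:R * h = 1) (hnm : (n < m)%N) (VV : V *m star V = 1%:M).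

Let V1 := V1 R n m.
Let V1V1 : V1 *m star V1 = 1%:M := V1_star R (ltnW hnm).

Definition homotopy (g : 'M[{poly R}]_(n.*2)) :=
  [/\ g *m star g = 1%:M, star g *m g = 1%:M & eval_mx 0 g = 1%:M].

Definition good s := exists N, forall g, homotopy g ->
  exists2 e : 'M[R]_(m.*2), EO e &
    transport V (eval_mx (s ^+ N) g) = transport V1 (eval_mx (s ^+ N) g) *m e.

Lemma star_map (R' R'' : comNzRingType) (f : R' -> R'') p q (A : 'M[R']_(p.*2, q.*2)) :
  map_mx f (star A) = star (map_mx f A).
Proof. by apply/matrixP=> i j; rewrite mxE !starE mxE. Qed.

Lemma eval_star a p q (g : 'M[{poly R}]_(p.*2, q.*2)) :
  eval_mx a (star g) = star (eval_mx a g).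
Proof. exact: star_map. Qed.

Lemma eval_mxM a p q r (A : 'M[{poly R}]_(p, q)) (B : 'M_(q, r)) :
  eval_mx a (A *m B) = eval_mx a A *m eval_mx a B.
Proof. exact: map_mxM. Qed.

Lemma eval_mx1 a p : eval_mx a (1%:M : 'M[{poly R}]_p) = 1%:M.
Proof. exact: map_mx1. Qed.

Lemma eval_const a p q (A : 'M[R]_(p, q)) : eval_mx a (const_polymx A) = A.
Proof. by apply/matrixP=> i j; rewrite !mxE /= /horner_eval hornerC. Qed.

Definition subst_mx (a b : R) p q (g : 'M[{poly R}]_(p, q)) :=
  map_mx (comp_poly (a *: 'X + b%:P)) g.

Lemma eval_subst a b c p q (g : 'M[{poly R}]_(p, q)) :
  eval_mx c (subst_mx a b g) = eval_mx (a * c + b) g.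
Proof.
by apply/matrixP=> i j; rewrite !mxE /= /horner_eval horner_comp !hornerE.
Qed.

Lemma subst_orth a b (g : 'M[{poly R}]_(n.*2)) : g *m star g = 1%:M ->
  subst_mx a b g *m star (subst_mx a b g) = 1%:M.
Proof. by move=> gg; rewrite -star_map -map_mxM gg map_mx1. Qed.

Lemma subst_orth' a b (g : 'M[{poly R}]_(n.*2)) : star g *m g = 1%:M ->
  star (subst_mx a b g) *m subst_mx a b g = 1%:M.
Proof. by move=> gg; rewrite -star_map -map_mxM gg map_mx1. Qed.

Lemma homotopy_subst a g : homotopy g -> homotopy (subst_mx a 0 g).
Proof.
move=> [g1 g2 g0]; split; [exact: subst_orth|exact: subst_orth'|].
by rewrite eval_subst mulr0 addr0.
Qed.

Lemma homotopy_eval a g : homotopy g ->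
  eval_mx a g *m star (eval_mx a g) = 1%:M /\ star (eval_mx a g) *m eval_mx a g = 1%:M.
Proof. by move=> [g1 g2 _]; rewrite -eval_star -!eval_mxM g1 g2 eval_mx1. Qed.

Lemma good_sub s a g : homotopy g -> forall N, (forall g, homotopy g ->
  exists2 e : 'M[R]_(m.*2), EO e &
    transport V (eval_mx (s ^+ N) g) = transport V1 (eval_mx (s ^+ N) g) *m e) ->
  exists2 e : 'M[R]_(m.*2), EO e &
    transport V (eval_mx (s ^+ N * a) g) = transport V1 (eval_mx (s ^+ N * a) g) *m e.
Proof.
move=> hg N /(_ _ (homotopy_subst a hg)).
by rewrite !eval_subst addr0 mulrC.
Qed.

Lemma good0 : good 0.
Proof.
(* The exponent must be positive, as [0 ^+ 0] is 1. *)
exists 1 => g [_ _ g0]; exists 1%:M; first exact: generated_one.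
by rewrite expr1 g0 !transport1 mulmx1.
Qed.

Lemma good_mul s t : good s -> good (s * t).
Proof.
by move=> [N gN]; exists N => g hg; rewrite exprMn; apply: good_sub.
Qed.

Lemma good_exp s k : good (s ^+ k) -> good s.
Proof. by move=> [N gN]; exists (k * N)%N => g hg; rewrite exprM; apply: gN. Qed.

(** One factor [s + t] splits the claim into those for the exponents [N], [N'.+1] and [N.+1],
    [N']. *)
Lemma comaximal_exp (s t : R) N N' :
  exists a b, (s + t) ^+ (N + N') = s ^+ N * a + t ^+ N' * b.
Proof.
elim: N N' => [|N IHN] N'; first by exists ((s + t) ^+ N'), 0; rewrite expr0 add0n; ring.
elim: N' => [|N' [a' [b' e']]].
  by exists 0, ((s + t) ^+ N.+1); rewrite expr0 addn0; ring.
have [a [b e]] := IHN N'.+1.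
exists (a + t * a'), (s * b + b'); rewrite addSn exprS mulrDl {1}e addnS -addSn e' !exprS.
by ring.
Qed.

(** With [B = t^N' b] and [g'(T) = g(a T + B) g(B)^-1], which is again a homotopy,
    [g(s^N a + B) = g'(s^N) g(B)]. The two factors are covered by [s] and [t]; normality moves the
    elementary matrix between them to the right. *)
Lemma goodD s t : good s -> good t -> good (s + t).
Proof.
move=> [N gN] [N' gN']; exists (N + N')%N => g hg.
have [a [b ->]] := comaximal_exp s t N N'; set B := t ^+ N' * b.
have [gB1 gB2] := homotopy_eval B hg; have [g1 g2 g0] := hg.
pose g' := subst_mx a B g *m star (const_polymx (eval_mx B g)).
have cst1 : const_polymx (eval_mx B g) *m star (const_polymx (eval_mx B g)) = 1%:M.
  by rewrite -star_map -map_mxM gB1 map_mx1.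
have cst2 : star (const_polymx (eval_mx B g)) *m const_polymx (eval_mx B g) = 1%:M.
  by rewrite -star_map -map_mxM gB2 map_mx1.
have hg' : homotopy g'.
  split.
  - by rewrite /g' starM starK mulmxA -(mulmxA _ _ (const_polymx _)) cst2 mulmx1 subst_orth.
  - by rewrite /g' starM starK mulmxA -(mulmxA _ _ (subst_mx _ _ _)) subst_orth' // mulmx1 cst1.
  - by rewrite eval_mxM eval_subst mulr0 add0r eval_star eval_const.
have [e Ee] := gN _ hg'; have [e' Ee' sB] := good_sub b hg gN'.
rewrite eval_mxM eval_subst eval_star eval_const (mulrC a) => eg'.
have -> : eval_mx (s ^+ N * a + B) g =
    eval_mx (s ^+ N * a + B) g *m star (eval_mx B g) *m eval_mx B g.
  by rewrite -mulmxA gB2 mulmx1.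
rewrite (transportM VV) (transportM V1V1) eg' sB.
exists (transport V1 (star (eval_mx B g)) *m e *m transport V1 (eval_mx B g) *m e').
  by apply: generated_mul => //; apply: (EO_conj h2).
rewrite !mulmxA; congr (_ *m _ *m _).
by rewrite -(mulmxA (transport _ _) (transport V1 (eval_mx B g))) -(transportM V1V1) gB1 transport1 mulmx1.
Qed.

Lemma good_sum (I : finType) (P : pred I) (F : I -> R) :
  (forall i, P i -> good (F i)) -> good (\sum_(i | P i) F i).
Proof. by move=> gF; apply: big_ind => //; [apply: good0 | apply: goodD]. Qed.

Lemma good1 g : good 1 -> homotopy g ->
  exists2 e : 'M[R]_(m.*2), EO e & transport V (eval_mx 1 g) = transport V1 (eval_mx 1 g) *m e.
Proof. by move=> [N gN] /gN; rewrite expr1n. Qed.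

End Patching.

(** * Row reduction over localizations *)

Section PolyX.
Variable R : comNzRingType.

Lemma poly_split_X (p : {poly R}) : p = p.[0]%:P + drop_poly 1 p * 'X.
Proof.
apply/polyP=> i; rewrite coefD coefC coefMX coef_drop_poly horner_coef0.
by case: i => [|i]; rewrite /= ?addr0 ?add0r ?addn1.
Qed.

Lemma mulX_eq0 (p : {poly R}) : 'X * p = 0 -> p = 0.
Proof.
by move=> e; apply/polyP=> i; have := congr1 (fun q : {poly R} => q`_i.+1) e; rewrite coefXM !coef0.
Qed.

Lemma eval_divX p q (g : 'M[{poly R}]_(p, q)) (A : 'M[R]_(p, q)) :
  eval_mx 0 g = A -> exists g0, g = const_polymx A + 'X *: g0.
Proof.
move=> <-; exists (map_mx (drop_poly 1) g); apply/matrixP=> i j.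
by rewrite !mxE mulrC; apply: poly_split_X.
Qed.

Lemma eval_mxD a p q (A B : 'M[{poly R}]_(p, q)) :
  eval_mx a (A + B) = eval_mx a A + eval_mx a B.
Proof. exact: map_mxD. Qed.

Lemma eval_mxZ a b p q (A : 'M[{poly R}]_(p, q)) :
  eval_mx a (b *: A) = b.[a] *: eval_mx a A.
Proof. exact: map_mxZ. Qed.

End PolyX.

Section Local.
Variables (R : comNzRingType) (h : R) (n m : nat) (V : 'M[R]_(n.*2, m.*2)).
Hypotheses (h2 : 2%:R * h = 1) (hnm : (n < m)%N) (hm : (4 <= m)%N).
Hypothesis VV : V *m star V = 1%:M.

Let V1 := V1 R n m.

(** The variable is not a zero divisor, so the orthogonality relation for [1 + 'X g0] is divided by
    it before evaluation at [a], which may be a zero divisor. *)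
Lemma homotopy_qorth (g : 'M[{poly R}]_(n.*2)) : homotopy g ->
  exists g0, (forall a, eval_mx a g = 1%:M + a *: eval_mx a g0) /\
    forall a, eval_mx a g0 + star (eval_mx a g0)
      + a *: (eval_mx a g0 *m star (eval_mx a g0)) = 0.
Proof.
move=> [g1 _ g0]; have [d] := eval_divX g0; rewrite /const_polymx map_mx1 => eg.
exists d; split=> a; first by rewrite {1}eg eval_mxD eval_mx1 eval_mxZ hornerX.
have : 'X *: (d + star d + 'X *: (d *m star d)) = 0.
  apply: (addrI 1%:M); rewrite addr0 -[RHS]g1 eg starD star1 starZ; mx_expand.
  by mx_entries; ring.
move=> X0; have d0 : d + star d + 'X *: (d *m star d) = 0.
  apply/matrixP=> i j; rewrite mx0E; apply: mulX_eq0.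
  by rewrite -scalemxE X0 mx0E.
have := congr1 (eval_mx a) d0.
by rewrite !eval_mxD eval_mxZ eval_mxM eval_star hornerX => ->; apply: map_mx0.
Qed.

(** Over the localization [V] is [V1 *m M / mu], so [transport V] is [transport V1] conjugated by
    [M / mu]; admissibility makes the difference elementary. *)
Lemma good_reach s k : reach V s k (k *: V1) -> good V s.
Proof.
move=> [sk0 [t [st _ [M [mu [[smu MM1 MM2 [N NP]] UM]]]]]].
have {UM} UM : (t * k) *: (V1 *m M) = (t * k * mu) *: V.
  by rewrite -UM scalemxAl scalerA.
have sk := dvpM st sk0; move: (t * k) sk UM => {st sk0} {}k sk UM.
have sMU : k *: (star M *m star V1) = (k * mu) *: star V.
  by rewrite -starM -!starZ UM.
have [d1 [k1 e1]] := sk; have [d2 [k2 e2]] := smu.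
(* [N] is the divisibility asked for by [adm]; the other powers clear the denominators [k * k] and
   [mu * mu]. *)
exists (N + (k1 + k1) + (k2 + k2))%N => g hg.
have [g0 [eg og]] := homotopy_qorth hg.
set Y := s ^+ _; set b := d1 * d1 * (d2 * d2); set z := s ^+ N.
have YE : Y = z * (k * k) * (mu * mu) * b by rewrite /Y !exprD -e1 -e2 /b /z; ring.
have [|_ /(_ ((k * k * b) *: eval_mx Y g0)) []] := NP 1 1 z.
- by exists 1; rewrite !mulr1.
- rewrite /qorth !starZ -scalemxAl -scalemxAr !scalerA.
  transitivity ((k * k * b) *: (eval_mx Y g0 + star (eval_mx Y g0)
      + Y *: (eval_mx Y g0 *m star (eval_mx Y g0)))); last by rewrite og scaler0.
  by rewrite YE !scalerDr !scalerA; congr (_ + _ *: _); ring.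
move=> e Qe ee; exists (1%:M + e); first exact: tracked_EO Qe.
have [eg' ext_g] : transport V (eval_mx Y g) =
    1%:M + star M *m (z *: ext m ((k * k * b) *: eval_mx Y g0)) *m M
   /\ transport V1 (eval_mx Y g) = 1%:M + (mu * mu * z) *: ext m ((k * k * b) *: eval_mx Y g0).
  rewrite eg /transport [1%:M + _ - _]addrC addKr; split; congr (_ + _); last first.
    rewrite extZ /ext -scalemxAr -scalemxAl scalerA -/V1; congr (_ *: _).
    by rewrite YE; ring.
  rewrite extZ scalerA /ext -/V1.
  transitivity ((z * b) *: ((k *: (star M *m star V1)) *m eval_mx Y g0 *m (k *: (V1 *m M)))).
    rewrite UM sMU -!scalemxAl -!scalemxAr -!scalemxAl !scalerA; congr (_ *: _).
    by rewrite YE; ring.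
  rewrite -!scalemxAl -!scalemxAr -!scalemxAl !scalerA !mulmxA; congr (_ *: _).
  by ring.
rewrite eg' ext_g ee; have := qopE 1 ((mu * mu * z) *: ext m ((k * k * b) *: eval_mx Y g0)) e.
by rewrite !scale1r.
Qed.

End Local.

Section Reduction.
Variables (R : comNzRingType) (h : R) (n m : nat) (V : 'M[R]_(n.*2, m.*2)).
Hypotheses (h2 : 2%:R * h = 1) (hnm : (n < m)%N) (hm : (4 <= m)%N).
Hypothesis VV : V *m star V = 1%:M.
Implicit Types (s k w x y t : R) (U : 'M[R]_(n.*2, m.*2)).

Lemma le_nm2 : (n.*2 <= m.*2)%N. Proof. by rewrite leq_double ltnW. Qed.

Let wd : 'I_(n.*2) -> 'I_(m.*2) := widen_ord le_nm2.

Lemma wd_sigma0 p : wd (sigma0 p) = sigma0 (wd p).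
Proof. exact: val_inj. Qed.

Lemma root_entry U w a (i j : 'I_(m.*2)) r c : (U *m root_mx w a i j) r c =
  w * U r c + a * (U r i * (sigma0 c == j)%:R - U r j * (sigma0 c == i)%:R).
Proof.
rewrite /root_mx /wedge -(scalemx1 _ w); mx_expand.
rewrite !(addmxE, oppmxE, scalemxE) -!colE mxE big_ord1 dualE evE.
by rewrite mxE [(col j U *m _) r c]mxE big_ord1 dualE evE mxE; ring.
Qed.

Lemma eichler_entry U w (j : 'I_(m.*2)) (v : 'cV_(m.*2)) r c : (U *m eichler h w j v) r c =
  w * w * U r c + w * ((U *m v) r 0 * (sigma0 c == j)%:R - U r j * v (sigma0 c) 0)
    - h * bf v v * U r j * (sigma0 c == j)%:R.
Proof.
rewrite /eichler /wedge -(scalemx1 _ (w * w)); mx_expand.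
rewrite !(addmxE, oppmxE, scalemxE) -!colE.
rewrite [(U *m v *m _) r c]mxE big_ord1 dualE evE.
rewrite [(col j U *m _) r c]mxE big_ord1 dualE [(col j U) r 0]mxE.
by rewrite [(col j U *m _) r c]mxE big_ord1 dualE [(col j U) r 0]mxE evE; ring.
Qed.

Definition std (d : nat) k U := forall (r : 'I_(n.*2)) c,
  (r < d)%N -> U r c = k * (wd r == c)%:R.

Lemma std_scale d t k U : std d k U -> std d (t * k) (t *: U).
Proof. by move=> sU r c rd; rewrite scalemxE sU // mulrA. Qed.

Lemma rows_form k U : U *m star U = (k * k)%:M -> forall p r,
  \sum_c U p c * U r (sigma0 c) = k * k * (r == sigma0 p)%:R.
Proof.
move=> UU p r; have := congr1 (fun A : 'M_(n.*2) => A p (sigma0 r)) UU.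
rewrite !mxE mulr_natr eq_sym -sigma0_eqC => <-; apply: eq_bigr => c _.
by rewrite starE sigma0K.
Qed.

(** Pairing row [p] with a finished row, a multiple of a basis row, isolates one entry. The relation
    comes multiplied by [t * k], so this factor is absorbed into the new scalar. *)
Lemma normalize s d k U : reach V s k U -> std d k U ->
  exists2 t, dvp s t & [/\ reach V s (t * k) (t *: U),
    (t *: U) *m star (t *: U) = (t * k * (t * k))%:M &
    forall p (r : 'I_(n.*2)), (r < d)%N -> (t *: U) p (sigma0 (wd r)) = t * k * (r == sigma0 p)%:R].
Proof.
move=> rU sU; have [sk [t [st UU _]]] := rU.
have stk : dvp s (t * k) by apply: dvpM.
exists (t * k * t); first exact: dvpM.
have tU : (t * k * t) *: U = (t * k) *: (t *: U) by rewrite scalerA.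
split; first by apply: reach_scale => //; apply: dvpM.
  rewrite tU starZ -scalemxAl -scalemxAr UU !scale_scalar_mx.
  by congr (_%:M); ring.
move=> p r rd; have := rows_form UU p r.
rewrite (bigD1 (sigma0 (wd r))) //= big1 => [|c ne].
  rewrite !scalemxE sigma0K addr0 (sU r) // eqxx mulr1 => e.
  transitivity (t * U p (sigma0 (wd r)) * (t * k)); first by ring.
  by rewrite e; ring.
rewrite [X in _ * X]scalemxE (sU r) // -sigma0_eqC eq_sym (negbTE ne).
by rewrite !mulr0.
Qed.

(** An Eichler matrix along the pivot column clears row [p] outside the pivot's pair. Isotropy of
    the row, with 2 invertible, kills the last entry up to a scalar. *)
Lemma clear_row s (p : 'I_(n.*2)) k U : reach V s k U -> std p k U -> U p (wd p) = k ->
  exists k' U', reach V s k' U' /\ std p.+1 k' U'.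
Proof.
move=> rU0 sU0 Up0; have [t _ [rU UU Uc]] := normalize rU0 sU0.
have sU := std_scale t sU0; have Up : (t *: U) p (wd p) = t * k by rewrite scalemxE Up0.
move: (t *: U) (t * k) rU UU Uc sU Up => {rU0 sU0 Up0 t}{}U {}k rU UU Uc sU Up.
have ssp : sigma0 (wd p) != wd p by apply: sigma0_neq.
(* The entries cancel row [p] against the pivot; the pivot's pair is omitted, as [reach_eichler]
   requires. *)
pose v : 'cV_(m.*2) := \col_c (if (c == wd p) || (c == sigma0 (wd p)) then 0 else U p (sigma0 c)).
have v1 : v (wd p) 0 = 0 by rewrite mxE eqxx.
have v2 : v (sigma0 (wd p)) 0 = 0 by rewrite mxE eqxx orbT.
have [sk _] := rU.
have rU1 := reach_eichler h2 hm hnm v1 v2 sk rU.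
set U1 := U *m _ in rU1.
have sU1 : std p (k * k * k) U1.
  move=> r c rp; rewrite eichler_entry !(sU r) //.
  have -> : (wd r == wd p) = false by apply: contraTF rp => /eqP[->]; rewrite ltnn.
  have -> : (U *m v) r 0 = 0.
    rewrite mxE (bigD1 (wd r)) //= big1 => [|l lr].
      rewrite mxE; case: ifP => [_|/norP[rp1 rp2]]; first by rewrite mulr0 addr0.
      rewrite Uc // (_ : (r == sigma0 p) = false) ?mulr0 ?addr0 //.
      by apply: contraNF rp2 => /eqP->; rewrite wd_sigma0.
    by rewrite (sU r) // eq_sym (negbTE lr) mulr0 mul0r.
  by rewrite /=; ring.
have U1p c : c != sigma0 (wd p) -> U1 p c = k * k * k * (wd p == c)%:R.
  move=> cp; rewrite eichler_entry Up.
  rewrite (_ : (sigma0 c == wd p) = false); last by rewrite sigma0_eqC (negbTE cp).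
  have [<-|pc] := eqVneq (wd p) c; first by rewrite Up v2 /=; ring.
  rewrite [v _ 0]mxE sigma0_eqC (negbTE cp) sigma0_eq eq_sym (negbTE pc) sigma0K /=.
  by rewrite mulr0; ring.
have [t st [rU2 UU2 _]] := normalize rU1 sU1.
have sU2 := std_scale t sU1.
(* The added factor is the pivot of [t *: U1]; isotropy says that twice its product with the
   leftover entry is zero. *)
exists (t * (k * k * k) * (t * (k * k * k))), ((t * (k * k * k)) *: (t *: U1)).
split; first by apply: reach_scale => //; case: rU2.
move=> r c; rewrite ltnS leq_eqVlt => /orP[/eqP/val_inj->|rp]; last first.
  exact: (std_scale _ sU2).
have [->|cp] := eqVneq c (sigma0 (wd p)); last by rewrite !scalemxE U1p //; ring.
rewrite eq_sym (negbTE ssp) mulr0 scalemxE.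
have := rows_form UU2 p p; rewrite eq_sym (negbTE (sigma0_neq p)) mulr0.
rewrite (bigD1 (wd p)) //= (bigD1 (sigma0 (wd p))) //= big1 => [|l /andP[c1 c2]].
  rewrite sigma0K addr0 !scalemxE U1p 1?eq_sym // eqxx => e.
  apply: (etrans _ (mul0r h)).
  by rewrite -[in RHS]e -[LHS]mul1r -{1}h2 /= mulr1n; ring.
by rewrite scalemxE U1p // eq_sym (negbTE c1) !mulr0 mul0r.
Qed.

(** The root with scalar [U p c] adds a multiple of column [c] to column [c'], prescribing [y]
    there; the bounds protect the finished rows. *)
Lemma move_entry s d (p : 'I_(n.*2)) (c c' : 'I_(m.*2)) k y U : reach V s k U -> std d k U ->
    (d <= c)%N -> (d <= sigma0 c')%N -> c' != c -> c' != sigma0 c -> dvp s (U p c) ->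
  exists U', [/\ reach V s (U p c * k) U', std d (U p c * k) U' & U' p c' = U p c * y].
Proof.
move=> rU sU dc dc' cc' scc' sx.
exists (U *m root_mx (U p c) (y - U p c') c (sigma0 c')); split.
- apply: (reach_root h2 hm hnm) => //; first by rewrite eq_sym sigma0_eqC.
  by rewrite sigma0K eq_sym.
- move=> r l rd; rewrite root_entry !(sU r) //.
  have -> : (wd r == c) = false by apply: contraTF dc => /eqP<-; rewrite -ltnNge.
  have -> : (wd r == sigma0 c') = false by apply: contraTF dc' => /eqP<-; rewrite -ltnNge.
  by rewrite /=; ring.
rewrite root_entry eqxx sigma0_eqC (negbTE scc') /=; ring.
Qed.

Lemma good_dvp s x : dvp s x -> good V (s * x) -> good V s.
Proof.
move=> [d [k xd]] gx; apply: (@good_exp _ _ _ _ _ k.+1).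
by rewrite exprS -xd mulrA; apply: good_mul.
Qed.

(** Each entry of row [p] serves as a pivot after localization at it. These entries generate an
    ideal containing [k * k], so the resulting good elements patch to [s]. *)
Lemma good_step j s k U : (j < n)%N ->
    (forall s k U, reach V s k U -> std j.+1.*2 k U -> good V s) ->
  reach V s k U -> std j.*2 k U -> good V s.
Proof.
move=> jn IH rU0 sU0; have [t _ [rU UU Uc]] := normalize rU0 sU0.
have sU := std_scale t sU0.
move: (t *: U) (t * k) rU UU Uc sU => {rU0 sU0 t}{}U {}k rU UU Uc sU.
have j2 : (j.*2 < n.*2)%N by rewrite ltn_double.
pose p : 'I_(n.*2) := Ordinal j2.
have sp : sigma0 p = j.*2.+1 :> nat by rewrite /= /sigma0_nat odd_double.
have [sk _] := rU.
suff gU (c : 'I_(m.*2)) : (j.*2 <= c)%N -> good V (s * U p c).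
  apply: (@good_dvp _ (k * k)); first exact: dvpM.
  have := rows_form UU p (sigma0 p); rewrite eqxx mulr1 => <-.
  rewrite mulr_sumr; apply: (good_sum h2) => // c _; rewrite mulrA; apply: good_mul.
  have [/gU //|cj] := leqP j.*2 c.
  (* An entry in a finished column is the pairing of row [p] with a finished row, hence zero. *)
  have cj' : (sigma0 c < j.*2)%N by rewrite sigma0_lt.
  pose r : 'I_(n.*2) := Ordinal (ltn_trans cj' j2).
  have cr : c = sigma0 (wd r) by apply: val_inj; rewrite -[c in LHS]sigma0K.
  rewrite cr Uc // (_ : (r == sigma0 p) = false) ?mulr0; last first.
    by apply: contraTF (cj' : (r < j.*2)%N) => /eqP->; rewrite sp -leqNgt leqnSn.
  by rewrite ?mulr0; apply: good0.
move=> jc; have {rU}rU := reach_mulr (U p c) rU; move: rU.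
have : dvp (s * U p c) (U p c) by exists s, 1; rewrite mulrC.
move: (s * U p c) => {sk}s sx rU.
(* Over the localization at [s] the entry [U p c] is a unit; move it to column
   [wd p]. If it sits in the hyperbolic pair of [p], it first has to visit an
   outer column. *)
have [k1 [U1 [rU1 sU1 U1p]]] : exists k1 U1,
    [/\ reach V s k1 U1, std j.*2 k1 U1 & U1 p (wd p) = k1].
  have jsp : (j.*2 <= sigma0 (wd p))%N by rewrite (sp : nat_of_ord (sigma0 (wd p)) = _).
  have [cp|cp] := boolP ((c == wd p) || (c == sigma0 (wd p))); last first.
    move/norP: cp => [cp csp].
    have [||U' [r1 s1 e1]] := move_entry k rU sU jc jsp _ _ sx; first by rewrite eq_sym.
      by rewrite -sigma0_eqC eq_sym.
    by exists (U p c * k), U'.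
  set f := first_outer hnm.
  have cn : (c < n.*2)%N by case/orP: cp => /eqP->; rewrite ?sigma0_lt.
  have fc : f != c by apply: contraTneq cn => <-; rewrite ltnn.
  have fsc : f != sigma0 c
    by rewrite -sigma0_eqC; apply: contraTneq cn => <-; rewrite sigma0_lt ltnn.
  have jf : (j.*2 <= f)%N by rewrite ltnW.
  have jsf : (j.*2 <= sigma0 f)%N by rewrite leqNgt sigma0_lt -leqNgt.
  have [U2 [rU2 sU2 e2]] := move_entry 1 rU sU jc jsf fc fsc sx.
  rewrite mulr1 in e2; rewrite -e2 in rU2 sU2 sx.
  have [||U' [r1 s1 e1]] := move_entry (U2 p f * k) rU2 sU2 jf jsp _ _ sx.
  - by rewrite -val_eqE /= neq_ltn j2.
  - rewrite -sigma0_eqC; have : (sigma0 (wd p) < n.*2)%N by rewrite sigma0_lt.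
    by apply: contraTneq => ->; rewrite ltnn.
  by exists (U2 p f * (U2 p f * k)), U'.
have [k2 [U2 [rU2 sU2]]] := clear_row (p := p) rU1 sU1 U1p.
(* Pairing with the finished row [p] already puts the pivot of row [sigma0 p] in its column. *)
have [t _ [rU3 _ Uc3]] := normalize rU2 sU2.
have [k4 [U4 [rU4 sU4]]] : exists k' U', reach V s k' U' /\ std (sigma0 p).+1 k' U'.
  apply: (clear_row rU3); first by rewrite sp; apply: std_scale.
  by rewrite wd_sigma0 Uc3 ?sigma0K // eqxx mulr1.
by apply: IH rU4 _; rewrite doubleS -sp.
Qed.

Theorem good_all s : good V s.
Proof.
suff H i j : (j + i = n)%N -> forall s k U, reach V s k U -> std j.*2 k U -> good V s.
  by apply: (H n 0 _ s 1 V) => //; apply: reach0.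
elim: i j => [|i IH] j jn {}s k U rU sU; last first.
  by apply: (good_step _ _ rU sU); [lia | apply: IH; lia].
rewrite addn0 in jn; apply: (@good_reach R n m V s k).
suff <- : U = k *: V1 R n m by [].
by apply/matrixP=> r c; rewrite sU ?jn ?ltn_ord // scalemxE mxE -val_eqE.
Qed.

End Reduction.

(** * Relative elementary group and conclusion *)

Section Relative.
Variables (R : comNzRingType) (m : nat).
Implicit Types A B : 'M[{poly R}]_(m.*2).

Lemma map_oe (R' R'' : comNzRingType) (f : {rmorphism R' -> R''}) k (i j : 'I_(k.*2)) z :
  map_mx f (oe i j z) = oe i j (f z).
Proof. by rewrite /oe map_mxB map_mxD !map_mxZ map_mx1 !map_delta_mx. Qed.

Lemma map_inverse (R' R'' : comNzRingType) (f : {rmorphism R' -> R''}) k (A B : 'M[R']_k) :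
  is_inverse A B -> is_inverse (map_mx f A) (map_mx f B).
Proof. by move=> [AB BA]; split; rewrite -map_mxM (AB, BA) map_mx1. Qed.

Lemma map_EO (R' R'' : comNzRingType) (f : {rmorphism R' -> R''}) k (A : 'M[R']_(k.*2)) :
  EO A -> EO (map_mx f A).
Proof.
elim=> {A} [A [i [j [z [ij sij ->]]]]||A B _ EA _ EB|A B _ EA AB].
- by rewrite map_oe; apply: generated_mem; exists i, j, (f z).
- by rewrite map_mx1; apply: generated_one.
- by rewrite map_mxM; apply: generated_mul.
- exact: generated_inv EA (map_inverse f AB).
Qed.

Lemma EO_rel_conj G H A : EO G -> is_inverse G H -> EO_rel A -> EO_rel (G *m A *m H).
Proof.
move=> EG GH; have HG := is_inverse_sym GH; elim=> {A} [A|||].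
- move=> [G' [H' [i [j [f [EG' GH' ij Xf ->]]]]]]; apply: generated_mem.
  exists (G *m G'), (H' *m H), i, j, f; split; rewrite ?mulmxA //.
    exact: generated_mul.
  exact: is_inverseM.
- by rewrite mulmx1 GH.1; apply: generated_one.
- move=> A B _ EA _ EB.
  have -> : G *m (A *m B) *m H = (G *m A *m H) *m (G *m B *m H).
    by rewrite !mulmxA -(mulmxA _ H G) GH.2 mulmx1.
  exact: generated_mul.
- move=> A B _ EA AB; apply: generated_inv EA _.
  by rewrite -[G *m B *m H]mulmxA; apply: is_inverseM => //; apply: is_inverseM.
Qed.

Lemma oe_add (i j : 'I_(m.*2)) (y z : {poly R}) : i != j ->
  oe i j (y + z) = oe i j y *m oe i j z.
Proof.
move=> ij; rewrite !oe_wedge.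
have NN : wedge (ev {poly R} i) (ev {poly R} (sigma0 j))
    *m wedge (ev {poly R} i) (ev {poly R} (sigma0 j)) = 0.
  by apply: wedge_sq; rewrite sigma0K.
move: (wedge _ _) NN => N NN; mx_expand.
by rewrite NN; mx_entries; ring.
Qed.

(** A semidirect decomposition: with [a], [b] the constant parts, [A' a B' b = A' (a B' a^-1) a b],
    and the relative group is stable under conjugation. *)
Lemma EO_rel_decomp A : EO A ->
  exists2 B, EO_rel B & A = B *m const_polymx (eval_mx 0 A).
Proof.
have cst_hom A1 A2 : const_polymx (eval_mx 0 (A1 *m A2)) =
    const_polymx (eval_mx 0 A1) *m const_polymx (eval_mx 0 A2) :> 'M[{poly R}]_(m.*2).
  by rewrite eval_mxM; apply: map_mxM.
have EOc A1 : EO A1 -> EO (const_polymx (eval_mx 0 A1)).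
  by move=> E1; apply: map_EO; apply: map_EO.
elim=> {A} [A [i [j [z [ij sij ->]]]]||A B EA [A' EA' eA] EB [B' EB' eB]|A B EA [A' EA' eA] AB].
- rewrite /const_polymx /eval_mx !map_oe {1}(poly_split_X z) addrC oe_add //.
  exists (oe i j (drop_poly 1 z * 'X)) => //.
  apply: generated_mem; exists 1%:M, 1%:M, i, j, (drop_poly 1 z * 'X).
  split; rewrite ?mul1mx ?mulmx1 //; first exact: generated_one.
    by split; rewrite mulmx1.
  by exists (drop_poly 1 z).
- exists 1%:M; first exact: generated_one.
  by rewrite eval_mx1 /const_polymx map_mx1 mulmx1.
- have [C EC AC] := EO_inverse (EOc _ EA).
  exists (A' *m (const_polymx (eval_mx 0 A) *m B' *m C)).
    by apply: generated_mul => //; apply: EO_rel_conj => //; apply: EOc.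
  rewrite cst_hom !mulmxA -(mulmxA _ C) AC.2 mulmx1 -eA {1}eB.
  by rewrite !mulmxA.
have [A'' eA''] : exists A'', is_inverse A' A''.
  exists (const_polymx (eval_mx 0 A) *m B); split.
    by rewrite mulmxA -eA AB.1.
  have [C _ AC] := EO_inverse (EOc _ EA).
  have -> : A' = A *m C by rewrite eA -mulmxA [_ *m C]AC.1 mulmx1.
  by rewrite mulmxA -(mulmxA _ B A) AB.2 mulmx1 AC.1.
have [C EC AC] := EO_inverse (EOc _ EA).
have cB : C = const_polymx (eval_mx 0 B).
  by apply: is_inverse_uniq AC _; split; rewrite -cst_hom (AB.1, AB.2) eval_mx1; apply: map_mx1.
(* With [a] the constant part, [(A' a)^-1 = (a^-1 A'^-1 a) a^-1]. *)
exists (C *m A'' *m const_polymx (eval_mx 0 A)).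
  apply: EO_rel_conj => //; first exact: is_inverse_sym.
  exact: generated_inv EA' eA''.
rewrite -cB -(mulmxA _ _ C) AC.1 mulmx1; apply: is_inverse_uniq AB _.
by rewrite eA; apply: is_inverseM.
Qed.

Lemma EO_relP A : EO A -> eval_mx 0 A = 1%:M -> EO_rel A.
Proof.
move=> EA A0; have [B EB ->] := EO_rel_decomp EA.
by rewrite A0 /const_polymx map_mx1 mulmx1.
Qed.

End Relative.

(** Sylvester's identity: one block matrix is factored through either diagonal block. *)
Lemma det_1D (R : comNzRingType) p q (A : 'M[R]_(p, q)) (B : 'M[R]_(q, p)) :
  \det (1%:M + A *m B) = \det (1%:M + B *m A).
Proof.
have e1 : block_mx 1%:M (- B) A 1%:M =
    block_mx 1%:M 0 A 1%:M *m block_mx 1%:M (- B) 0 (1%:M + A *m B).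
  rewrite mulmx_block ?(mul1mx, mul0mx, mulmx0, mulmx1, addr0, add0r) mulmxN.
  by rewrite addrCA addNr addr0.
have e2 : block_mx 1%:M (- B) A 1%:M =
    block_mx 1%:M (- B) 0 1%:M *m block_mx (1%:M + B *m A) 0 A 1%:M.
  rewrite mulmx_block ?(mul1mx, mul0mx, mulmx0, mulmx1, addr0, add0r) mulNmx.
  by rewrite addrK.
have := congr1 determinant e1; rewrite e2 !det_mulmx !det_ublock !det_lblock !det1.
by rewrite !mul1r !mulr1.
Qed.

Section Block.
Variables (R : comNzRingType) (n m : nat) (hmn : (n + 2 <= m)%N).

Lemma star_V1E (i : 'I_(m.*2)) j : star (V1 R n m) i j = (j == i :> nat)%:R.
Proof.
rewrite starE mxE; congr (_%:R); congr (nat_of_bool _).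
by apply/eqP/eqP => /= [|->//]; rewrite /sigma0_nat; do 2!case: ifP; lia.
Qed.

Lemma perp_id_transport (D : 'M[R]_(n.*2)) : perp_id hmn D = transport (V1 R n m) D.
Proof.
apply/matrixP=> i j; rewrite castmxE /transport addmxE [1%:M i j]mxE.
have V1l (A : 'M[R]_(m.*2, n.*2)) (j' : 'I_(n.*2)) : j = j' :> nat -> (A *m V1 R n m) i j = A i j'.
  move=> ej; rewrite mxE (bigD1 j') //= mxE ej eqxx mulr1 big1 ?addr0 // => k kj.
  by rewrite mxE ej (_ : (k == j' :> nat) = false) ?mulr0 //; apply/negbTE.
have V1r (A : 'M[R]_(n.*2)) (i' : 'I_(n.*2)) k : i = i' :> nat -> (star (V1 R n m) *m A) i k = A i' k.
  move=> ei; rewrite mxE (bigD1 i') //= star_V1E ei eqxx mul1r big1 ?addr0 // => l li.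
  by rewrite star_V1E ei (_ : (l == i' :> nat) = false) ?mul0r //; apply/negbTE.
have V1l0 (A : 'M[R]_(m.*2, n.*2)) : (n.*2 <= j)%N -> (A *m V1 R n m) i j = 0.
  move=> nj; rewrite mxE big1 // => k _; rewrite mxE.
  by case: eqP => [kj|_]; rewrite ?mulr0 //; have := ltn_ord k; rewrite kj ltnNge nj.
have V1r0 (A : 'M[R]_(n.*2, m.*2)) : (n.*2 <= i)%N -> (star (V1 R n m) *m A) i j = 0.
  move=> ni; rewrite mxE big1 // => k _; rewrite star_V1E.
  by case: eqP => [kj|_]; rewrite ?mul0r //; have := ltn_ord k; rewrite kj ltnNge ni.
rewrite -[cast_ord _ i]splitK -[cast_ord _ j]splitK.
case: splitP => i' /= ei; case: splitP => j' /= ej; rewrite /perp.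
- rewrite block_mxEul (V1l _ j') // (V1r _ i') // addmxE oppmxE [1%:M i' j']mxE.
  rewrite -[i == j]val_eqE -[i' == j']val_eqE /= ei ej.
  by rewrite addrCA subrr addr0.
- rewrite block_mxEur mxE V1l0 ?ej ?leq_addr // addr0 -val_eqE /= ei ej.
  by case: eqP => // e; have := ltn_ord i'; rewrite e ltnNge leq_addr.
- rewrite block_mxEdl mxE -mulmxA V1r0 ?ei ?leq_addr // addr0 -val_eqE /= ei ej.
  by case: eqP => // e; have := ltn_ord j'; rewrite -e ltnNge leq_addr.
- rewrite block_mxEdr mxE V1l0 ?ej ?leq_addr // addr0.
  by rewrite -[i == j]val_eqE -[i' == j']val_eqE /= ei ej eqn_add2l.
Qed.
End Block.

Lemma map_transport (R' R'' : comNzRingType) (f : {rmorphism R' -> R''}) n m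
    (V : 'M[R']_(n.*2, m.*2)) g : map_mx f (transport V g) = transport (map_mx f V) (map_mx f g).
Proof. by rewrite /transport map_mxD !map_mxM map_mxB !map_mx1 star_map. Qed.

Lemma eval_transport (R : comNzRingType) a n m (V : 'M[{poly R}]_(n.*2, m.*2)) g :
  eval_mx a (transport V g) = transport (eval_mx a V) (eval_mx a g).
Proof. exact: map_transport. Qed.

Lemma map_V1 (R' R'' : comNzRingType) (f : {rmorphism R' -> R''}) n m :
  map_mx f (V1 R' n m) = V1 R'' n m.
Proof. by apply/matrixP=> i j; rewrite !mxE rmorph_nat. Qed.

Lemma O_star (R : comNzRingType) m (A : 'M[R]_(m.*2)) : O A ->
  A *m star A = 1%:M /\ star A *m A = 1%:M.
Proof.
move=> [_ AA].
have sA : star A *m A = 1%:M by rewrite star.unlock -!mulmxA (mulmxA A^T) AA phiK.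
by split=> //; apply: mulmx1C.
Qed.

Lemma star_O (R : comNzRingType) m (A : 'M[R]_(m.*2)) :
  A *m star A = 1%:M -> star A *m A = 1%:M -> O A.
Proof.
move=> As sA; split; first by exists (star A).
move: sA; rewrite star.unlock -!mulmxA => e.
by rewrite -[LHS]mul1mx -(phiK R m) -!mulmxA e mulmx1.
Qed.

Theorem theorem4p10 (R : comNzRingType) (half : exists h : R, 2%:R * h = 1)
    (n m : nat) (hn : (2 <= n)%N) (hmn : (n + 2 <= m)%N)
    (V : 'M[R]_(n.*2, m.*2)) (hV : OUm V)
    (delta : 'M[R]_(n.*2)) (hdelta : homotopic_to_id delta)
    (deltaT : 'M[{poly R}]_(n.*2)) (hdeltaT : homotopy_of delta deltaT) :
  exists sigmaT : 'M[{poly R}]_(m.*2),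
    [/\ SO_rel sigmaT,
        deltaT *m const_polymx V = const_polymx V *m sigmaT,
        (exists tauT : 'M[{poly R}]_(m.*2),
           is_inverse sigmaT tauT /\ EO_rel (tauT *m perp_id hmn deltaT)) &
        let sigma := eval_mx 1 sigmaT in
        delta *m V = V *m sigma /\
        exists tau : 'M[R]_(m.*2),
          is_inverse sigma tau /\ EO (tau *m perp_id hmn delta)].
Proof.
have [h h2] := half; have [[/O_star[D1 D2] detD] D0 De] := hdeltaT.
have hm : (4 <= m)%N by lia.
have hnm : (n < m)%N by lia.
have hT : 2%:R * h%:P = 1 :> {poly R} by rewrite -polyC_natr -polyCM h2.
have VV : V *m star V = 1%:M.
  by rewrite star.unlock !mulmxA (hV.2) phiK.
set W := const_polymx V.
have WW : W *m star W = 1%:M by rewrite -star_map -map_mxM VV map_mx1.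
(* [G] is [deltaT] in a second variable [Y] over [R[T]]. Substitution gives the homotopy
   [deltaT(T Y)], equal to 1 at [Y = 0] and to [deltaT] at [Y = 1]. *)
pose G := map_mx (map_poly polyC) deltaT.
have hG : homotopy (subst_mx 'X 0 G).
  have G1 : G *m star G = 1%:M by rewrite -star_map -map_mxM D1 map_mx1.
  have G2 : star G *m G = 1%:M by rewrite -star_map -map_mxM D2 map_mx1.
  split; [exact: subst_orth|exact: subst_orth'|].
  rewrite eval_subst mulr0 addr0.
  transitivity (const_polymx (eval_mx 0 deltaT)); last by rewrite D0 /const_polymx map_mx1.
  by apply/matrixP=> i j; rewrite !mxE /horner_eval !horner_coef0 coef_map.
have [e Ee] := good1 (good_all hT hnm hm WW 1) hG.
rewrite eval_subst mulr1 addr0.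
have -> : eval_mx 'X G = deltaT.
  by apply/matrixP=> i j; rewrite !mxE /horner_eval -[RHS]comp_polyXr.
set S := transport W deltaT; set S1 := transport _ deltaT => SE.
have [e' Ee' [ee' e'e]] := EO_inverse Ee.
have SS1 : S *m star S = 1%:M by rewrite star_transport -transportM // D1 transport1.
have SS2 : star S *m S = 1%:M by rewrite star_transport -transportM // D2 transport1.
(* The required quotient is the elementary matrix [e']; being 1 at [T = 0], it is relative
   elementary. *)
have S1S : star S *m S1 = e'.
  have -> : S1 = S *m e' by rewrite SE -mulmxA ee' mulmx1.
  by rewrite mulmxA SS2 mul1mx.
have S0 : eval_mx 0 S = 1%:M.
  by rewrite /S eval_transport D0 transport1.
have S10 : eval_mx 0 S1 = 1%:M.
  by rewrite /S1 eval_transport D0 transport1.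
have e'0 : eval_mx 0 e' = 1%:M.
  by rewrite -S1S eval_mxM eval_star S0 S10 star1 mulmx1.
have inv : is_inverse S (star S) by [].
exists S; split.
- split=> //; split; first exact: star_O.
  (* Exchanging the factors brings in [W *m star W = 1] and leaves [\det deltaT]. *)
  by rewrite /S /transport -mulmxA det_1D -mulmxA WW mulmx1 addrCA subrr addr0.
- by rewrite mul_transport.
- by exists (star S); rewrite perp_id_transport S1S; split=> //; apply: EO_relP.
have S1e : eval_mx 1 S = transport V delta.
  by rewrite /S eval_transport De eval_const.
split; first by rewrite S1e mul_transport.
exists (eval_mx 1 (star S)); split; first exact: map_inverse.
have -> : perp_id hmn delta = eval_mx 1 S1.
  by rewrite perp_id_transport /S1 eval_transport De [eval_mx _ _]map_V1.
by rewrite -eval_mxM S1S; apply: map_EO.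
Qed.
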